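(* Let $d \ge 1$ be an integer and let $s \in (0,1)$. For $\vec{p} \in \mathbb{Z}^d$ define $$\tilde{T}_{\vec{p}} = \frac{1}{(2\pi)^d} \int_{B_R(0)} |\vec{\xi}|^{2s} e^{i \vec{p}\cdot \vec{\xi}} \, d\vec{\xi}, \qquad R = 2\sqrt{\pi}\left(\Gamma\left(\tfrac{d}{2}+1\right)\right)^{1/d}.$$ Then $$\tilde{T}_{\vec{p}} = \mathcal{O}\left(\frac{1}{|\vec{p}|^{\frac{d+1}{2}}}\right) \quad \text{as } |\vec{p}| \to \infty,$$ where the implied constant may depend on $d$ and $s$ only.
   Context: Here $B_R(0) \subset \mathbb{R}^d$ is the ball of radius $R$ centered at the origin, $|\cdot|$ is the Euclidean norm, and $\Gamma$ is the gamma function. The radius $R$ is chosen so that $B_R(0)$ has the same volume as the cube $(-\pi,\pi)^d$. The numbers $\tilde{T}_{\vec{p}}$ are the entries of the stiffness matrix of the spectral approximation of the fractional Laplacian $(-\Delta)^s$; the index $\vec{p}$ is an integer multi-index. *)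

(* Defs.v *)
From HB Require Import structures.
From mathcomp Require Import all_boot all_order all_algebra.
From mathcomp Require Import all_classical all_reals all_analysis.
From mathcomp Require Import complex.

Set Implicit Arguments.
Unset Strict Implicit.
Unset Printing Implicit Defensive.

Import Order.TTheory GRing.Theory Num.Theory.
Import numFieldNormedType.Exports.

Local Open Scope classical_set_scope.
Local Open Scope ring_scope.
Local Open Scope complex_scope.

Section cons_measure.
Context disp (T : measurableType disp) (R : realType) (n : nat).
Variables (nu : {sigma_finite_measure set T -> \bar R}).
Variables (mu : {sigma_finite_measure set (n.-tuple T) -> \bar R}).

Definition tuple_cons (x : T * n.-tuple T) : n.+1.-tuple T :=
  [tuple of x.1 :: x.2].

Definition tuple_uncons (t : n.+1.-tuple T) : T * n.-tuple T :=
  (thead t, [tuple of behead t]).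

Lemma tuple_consK : cancel tuple_cons tuple_uncons.
Proof. by case=> x t; congr pair; apply: val_inj. Qed.

Lemma measurable_tuple_cons : measurable_fun [set: _] tuple_cons.
Proof. exact: measurable_cons. Qed.

Lemma measurable_tuple_uncons : measurable_fun [set: _] tuple_uncons.
Proof.
apply: measurable_fun_pair; last exact: measurable_behead.
exact: measurable_tnth.
Qed.

Definition cons_measure : set (n.+1.-tuple T) -> \bar R :=
  pushforward (nu \x mu)%E tuple_cons.

Let cons_measure0 : cons_measure set0 = 0%E.
Proof. by rewrite /cons_measure /pushforward preimage_set0 measure0. Qed.

Let cons_measure_ge0 A : (0 <= cons_measure A)%E.
Proof. exact: (measure_ge0 (nu \x mu)%E). Qed.

Let cons_measure_sigma_additive : semi_sigma_additive cons_measure.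
Proof.
move=> F mF tF mUF; rewrite /cons_measure /pushforward preimage_bigcup.
apply: measure_semi_sigma_additive.
- by move=> k; rewrite -[X in measurable X]setTI; exact: measurable_tuple_cons.
- apply/trivIsetP => /= i j _ _ ij; rewrite -preimage_setI.
  by move/trivIsetP : tF => /(_ _ _ _ _ ij) ->//; rewrite preimage_set0.
- rewrite -preimage_bigcup -[X in measurable X]setTI.
  exact: measurable_tuple_cons.
Qed.

HB.instance Definition _ := isMeasure.Build _ _ _ cons_measure
  cons_measure0 cons_measure_ge0 cons_measure_sigma_additive.

(* The library's sigma-finiteness instance for product measures is not found by
   unification (an earlier instance takes its key), hence the direct proof. *)
Let cons_measure_sigma_finite : sigma_finite setT cons_measure.
Proof.
have /sigma_finiteP[F [TF ndF Foo]] := sigma_finiteT nu.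
have /sigma_finiteP[G [TG ndG Goo]] := sigma_finiteT mu.
exists (fun k => tuple_uncons @^-1` (F k `*` G k)).
  rewrite -preimage_bigcup (_ : \bigcup_i _ = setT) ?preimage_setT//.
  rewrite -subTset => -[x y] _.
  have [[i _ Fx] [j _ Gy]] : (\bigcup_i F i) x /\ (\bigcup_i G i) y.
    by rewrite -TF -TG.
  exists (maxn i j) => //; split => /=.
    by move: x Fx; exact/subsetPset/ndF/leq_maxl.
  by move: y Gy; exact/subsetPset/ndG/leq_maxr.
move=> k; have [mF Fk] := Foo k; have [mG Gk] := Goo k; split.
  rewrite -[X in measurable X]setTI; apply: measurable_tuple_uncons => //.
  exact: measurableX.
rewrite /cons_measure /pushforward -comp_preimage.
rewrite (_ : _ \o _ = id); last exact/funext/tuple_consK.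
by rewrite preimage_id product_measure1E// lte_mul_pinfty// ge0_fin_numE.
Qed.

HB.instance Definition _ := Measure_isSigmaFinite.Build _ _ _ cons_measure
  cons_measure_sigma_finite.

End cons_measure.
Arguments tuple_cons {disp T n}.

(** R^d is the type of d-tuples of reals, which the library endows with the
    product sigma-algebra, i.e. the Borel sigma-algebra of R^d. *)
Notation Rn R d := (d.-tuple (measurableTypeR R)).

(** The d-fold product of the Lebesgue measure on R. It is the Lebesgue measure
    on the Borel sets of R^d: see the volume of boxes, [lebesgue_Rn_box]. *)
Fixpoint lebesgue_Rn (R : realType) (d : nat) :
    {sigma_finite_measure set (Rn R d) -> \bar R} :=
  match d with
  | 0 => (@dirac _ (Rn R 0) [tuple] R)
  | d'.+1 => cons_measure (@lebesgue_measure R) (lebesgue_Rn R d')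
  end.

Lemma lebesgue_Rn_box (R : realType) (d : nat) (a b : 'I_d -> R) :
  (forall i, a i <= b i) ->
  lebesgue_Rn R d [set x | forall i, tnth x i \in `[a i, b i]] =
  (\prod_(i < d) (b i - a i))%:E.
Proof.
elim: d a b => [|d IH] a b ab.
  by rewrite big_ord0 /= diracE mem_set// => -[].
rewrite big_ord_recl EFinM.
rewrite -(IH (fun i => a (lift ord0 i)) (fun i => b (lift ord0 i)))//.
rewrite /= /cons_measure /pushforward.
have -> : tuple_cons @^-1` [set x | forall i, tnth x i \in `[a i, b i]] =
    `[a ord0, b ord0]%classic `*`
    [set x : Rn R d | forall i : 'I_d,
      tnth x i \in `[a (lift ord0 i), b (lift ord0 i)]].
  apply/seteqP; split=> [[x t] /= H|[x t] /= [H0 H] i].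
    by split=> [|i]; [have := H ord0; rewrite tnth0|
      have := H (lift ord0 i); rewrite tnthS].
  by case: (unliftP ord0 i) => [j ->|->]; rewrite ?tnth0 ?tnthS.
rewrite product_measure1E//.
  congr (_ * _)%E; rewrite /= lebesgue_measure_itv/= lte_fin.
  have := ab ord0; rewrite le_eqVlt => /predU1P[->|->//].
  by rewrite ltxx subrr.
rewrite (_ : [set x | _] = \bigcap_(i in [set: 'I_d])
    (fun x : Rn R d => tnth x i) @^-1`
      `[a (lift ord0 i), b (lift ord0 i)]%classic); last first.
  by apply/seteqP; split=> x /= H i; [move=> _|]; apply: H.
apply: fin_bigcap_measurable => // i _.
by rewrite -[X in measurable X]setTI; exact: measurable_tnth.
Qed.

Section euclidean.
Context (R : realType) (d : nat).
Implicit Types x y : Rn R d.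

Definition dotp x y : R := \sum_(i < d) tnth x i * tnth y i.

Definition enorm x : R := Num.sqrt (dotp x x).

Definition eball (r : R) : set (Rn R d) := [set x | enorm x < r].

Definition multi_index (p : d.-tuple int) : Rn R d :=
  [tuple of map (fun k : int => k%:~R : R) p].

(** The filter "|p| --> +oo" on Z^d. *)
Definition index_infty : set_system (d.-tuple int) :=
  filter_from [set: R] (fun M => [set p | M < enorm (multi_index p)]).

Global Instance index_infty_filter : Filter index_infty.
Proof.
apply: filter_fromT_filter; first by exists 0.
move=> M N; exists (Num.max M N) => p /=.
by rewrite gt_max => /andP[].
Qed.
Canonical index_infty_filter_on := FilterType index_infty index_infty_filter.

End euclidean.
Arguments index_infty R d : clear implicits.
Arguments eball {R d}.

(** For d >= 1 the filter is proper, so that big-O along it is not vacuous. *)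
Global Instance index_infty_proper (R : realType) (d : nat) :
  ProperFilter (index_infty R d.+1).
Proof.
apply: filter_from_proper => M _.
pose N := (Num.truncn `|M|).+1.
exists [tuple of nseq d.+1 N%:Z] => /=.
have MN : M < N%:R by rewrite (le_lt_trans (ler_norm M))// truncnS_gt.
apply: (lt_le_trans MN).
rewrite -[leLHS]ger0_norm// -sqrtr_sqr ler_sqrt; last first.
  by apply: sumr_ge0 => i _; rewrite -expr2 sqr_ge0.
rewrite /dotp (bigD1 ord0)//= tnth_map tnth_nseq -expr2 lerDl.
by apply: sumr_ge0 => i _; rewrite -expr2 sqr_ge0.
Qed.

(** Meaningful when the real and imaginary parts are integrable, as for a
    bounded measurable integrand on a bounded set. *)
Definition cintegral disp (T : measurableType disp) (R : realType)
    (mu : {measure set T -> \bar R}) (D : set T) (f : T -> R[i]) : R[i] :=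
  (\int[mu]_(x in D) complex.Re (f x)) +i* (\int[mu]_(x in D) complex.Im (f x)).

Definition cexp (R : realType) (z : R[i]) : R[i] :=
  (expR (complex.Re z))%:C * (cos (complex.Im z) +i* sin (complex.Im z)).

(** Euler's integral; the library has no gamma function. *)
Definition Gamma (R : realType) (x : R) : R :=
  \int[@lebesgue_measure R]_(t in `]0, +oo[) (t `^ (x - 1) * expR (- t)).

(** The radius of the ball of R^d with the volume of the cube (-pi, pi)^d. *)
Definition radius (R : realType) (d : nat) : R :=
  2 * Num.sqrt pi * Gamma (d%:R / 2 + 1) `^ (d%:R^-1).

Definition T_tilde (R : realType) (d : nat) (s : R) (p : d.-tuple int) : R[i] :=
  (((2 * pi) ^+ d)^-1)%:C *
  cintegral (lebesgue_Rn R d) (eball (radius R d))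
    (fun xi => (enorm xi `^ (2 * s))%:C *
               cexp ('i * (dotp (multi_index R p) xi)%:C)).

(* Main.v *)
(** Write [B_r] for the ball of radius [r] in [R^d]. By the layer-cake formula
    [|xi|^(2s) = r^(2s) - \int_0^(r^(2s)) 1_(|xi|^(2s) < w) dw] on [B_r], it
    suffices to bound the Fourier transforms of the indicators of the balls
    [B_a], uniformly in [a <= r]. Lebesgue measure is invariant under plane
    rotations, so one may align [p] with a coordinate axis one coordinate at a
    time; slicing the ball then gives a constant multiple of
    [a^d \int_[-1,1] (1 - t^2)^((d-1)/2) cos(a |p| t + th) dt], which is
    [O(|p|^(-(d+1)/2))] by repeated integration by parts. Each integration by
    parts lowers the exponent of [sqrt (1 - t^2)] by 2, which leaves the
    exponents 0 and 1. *)

Require Import Defs.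
From HB Require Import structures.
From mathcomp Require Import all_boot all_order all_algebra.
From mathcomp Require Import all_classical all_reals all_analysis.
From mathcomp Require Import complex.
From mathcomp Require Import measurable_realfun ring lra.

Set Implicit Arguments.
Unset Strict Implicit.
Unset Printing Implicit Defensive.

Import Order.TTheory GRing.Theory Num.Theory.
Import numFieldNormedType.Exports.

Local Open Scope classical_set_scope.
Local Open Scope ring_scope.

(** * Affine changes of variables and plane rotations *)

(** The weight [|xi|^(2s)] is not smooth at the origin, so integrating by parts against it directly
    would meet a second singularity besides the boundary of the ball. The layers remove it: an
    indicator has a power of a half circle as its one-dimensional profile, singular only at the two
    endpoints. Uniformity over the layers comes from scaling. In dimension n a ball of radius rho
    contributes rho^n (rho |p|)^(-(n+1)/2), and the remaining power rho^((n-1)/2) is nonnegative, so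
    small balls are harmless. Everything is done with a real cosine of arbitrary phase. This class
    is stable under integration by parts, and the phases 0 and -pi/2 give the real and imaginary
    parts. The geometric reduction is carried out for nonnegative integrands in the extended reals,
    where Tonelli needs no integrability; the signed cosine enters only afterwards. *)

Section affine.
Context {R : realType}.
Notation mu := (@lebesgue_measure R).
Notation mR := (measurableTypeR R).

Lemma measurable_affine (r c : R) : measurable_fun [set: R] (fun x => r * x + c).
Proof. by apply: measurable_funD => //; apply: measurable_funM. Qed.

(** Scaled by [r], the pushforward gives half-open intervals their length, so uniqueness of the
    Lebesgue measure identifies the two. *)
Lemma lebesgue_measure_affine (r c : R) (A : set R) : 0 < r -> measurable A ->
  pushforward mu ((fun x => r * x + c) : mR -> mR) A = ((r^-1)%:E * mu A)%E.
Proof.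
move=> r0 mA.
have ri0 : 0 <= r by exact: ltW.
pose f : mR -> mR := fun x => r * x + c.
have mf : measurable_fun [set: mR] f by exact: measurable_affine.
have H : mu A = pushforward (mscale (NngNum ri0) mu) f A.
  apply: lebesgue_measure_unique => // _ [[a b]] _ <- /=.
  rewrite /pushforward /mscale/=.
  have -> : f @^-1` `]a, b] = `](a - c) / r, (b - c) / r]%classic.
    apply/seteqP; split => x /=; rewrite !in_itv/= /f ltr_pdivrMr// ler_pdivlMr//;
      rewrite ltrBlDr lerBrDr mulrC //.
  rewrite !lebesgue_measure_itv/= !lte_fin.
  rewrite ltr_pM2r ?invr_gt0// ltrD2r.
  case: ifPn => _; last by rewrite mule0.
  rewrite -!EFinB -EFinM; congr (_%:E); field; exact: lt0r_neq0.
rewrite H /pushforward /mscale/= muleA -EFinM mulVf ?lt0r_neq0// mul1e //.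
Qed.

Lemma ge0_integral_affine (f : R -> \bar R) (r c : R) : 0 < r ->
  measurable_fun [set: R] f -> (forall x, 0 <= f x)%E ->
  (\int[mu]_x f (r * x + c)%R = (r^-1)%:E * \int[mu]_x f x)%E.
Proof.
move=> r0 mf f0.
have ri0 : 0 <= r^-1 by rewrite invr_ge0 ltW.
pose phi : mR -> mR := fun x => r * x + c.
have mphi : measurable_fun [set: mR] phi by exact: measurable_affine.
have := @ge0_integral_pushforward _ _ mR mR R phi mphi mu setT f measurableT mf (fun x _ => f0 x).
rewrite preimage_setT => <-.
rewrite -(ge0_integral_mscale mu measurableT (NngNum ri0)) //.
by apply: eq_measure_integral => A mA _; exact: lebesgue_measure_affine.
Qed.

Lemma ge0_integral_translation (f : R -> \bar R) (c : R) :
  measurable_fun [set: R] f -> (forall x, 0 <= f x)%E ->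
  (\int[mu]_x f (x + c)%R = \int[mu]_x f x)%E.
Proof.
move=> mf f0; have := ge0_integral_affine c ltr01 mf f0.
rewrite invr1 mul1e => <-.
by apply: eq_integral => x _; rewrite mul1r.
Qed.

End affine.

Section rotation.
Context {R : realType}.
Notation mu := (@lebesgue_measure R).
Local Open Scope ereal_scope.
Implicit Type K : R * R -> \bar R.

Lemma ge0_integral_shearx K (a : R) : measurable_fun [set: R * R] K ->
  (forall z, 0 <= K z) ->
  \int[mu]_x \int[mu]_y K (x + a * y, y)%R = \int[mu]_x \int[mu]_y K (x, y).
Proof.
move=> mK K0.
have m1 : measurable_fun [set: R * R] (fun z => K (z.1 + a * z.2, z.2)%R).
  apply: (measurableT_comp mK).
  apply: measurable_fun_pair => //; apply: measurable_funD => //.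
  exact: measurable_funM.
rewrite (@fubini_tonelli _ _ _ _ _ mu mu (fun z => K (z.1 + a * z.2, z.2)%R))//=.
rewrite (@fubini_tonelli _ _ _ _ _ mu mu K)//=.
apply: eq_integral => y _.
apply: (ge0_integral_translation (f := fun x => K (x, y))) => //.
exact: (measurableT_comp mK).
Qed.

Lemma ge0_integral_sheary K (b : R) : measurable_fun [set: R * R] K ->
  (forall z, 0 <= K z) ->
  \int[mu]_x \int[mu]_y K (x, y + b * x)%R = \int[mu]_x \int[mu]_y K (x, y).
Proof.
move=> mK K0; apply: eq_integral => x _.
apply: (ge0_integral_translation (f := fun y => K (x, y))) => //.
exact: (measurableT_comp mK).
Qed.

(* A rotation other than +-1 is a product of three shears; each shear preserves
   the iterated integral by Tonelli and translation invariance. *)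
Lemma ge0_integral_rotation K (c s : R) : measurable_fun [set: R * R] K ->
  (forall z, 0 <= K z) -> s != 0%R -> (c ^+ 2 + s ^+ 2 = 1)%R ->
  \int[mu]_x \int[mu]_y K (c * x + s * y, c * y - s * x)%R =
  \int[mu]_x \int[mu]_y K (x, y).
Proof.
move=> mK K0 s0 cs.
(* If [c] and [s] are the cosine and sine of an angle, [a] is the tangent of half of it. The
   rotation is the horizontal shear by [a], the vertical one by [- s], and the horizontal one by [a]
   again. *)
pose a := ((1 - c) / s)%R.
pose K1 := fun z : R * R => K (z.1 + a * z.2, z.2)%R.
pose K2 := fun z : R * R => K1 (z.1, z.2 - s * z.1)%R.
have mK1 : measurable_fun [set: R * R] K1.
  apply: (measurableT_comp mK).
  apply: measurable_fun_pair => //; apply: measurable_funD => //.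
  exact: measurable_funM.
have mK2 : measurable_fun [set: R * R] K2.
  apply: (measurableT_comp mK1).
  apply: measurable_fun_pair => //; apply: measurable_funB => //.
  exact: measurable_funM.
have K10 z : 0 <= K1 z by exact: K0.
have K20 z : 0 <= K2 z by exact: K0.
rewrite -(ge0_integral_shearx a mK K0).
rewrite -(ge0_integral_sheary (- s) mK1 K10).
under [RHS]eq_integral do under eq_integral do rewrite mulNr.
rewrite -(ge0_integral_shearx a mK2 K20)/=.
apply: eq_integral => x _; apply: eq_integral => y _.
rewrite /K2 /K1/=; congr (K (_, _)); rewrite /a; last by field.
have e : (s * s = (1 - c) * (1 + c))%R.
  by move: cs => /(canRL (addKr _)) e; rewrite -expr2 e; ring.
apply/subr0_eq.
rewrite (_ : _ - _ = y / s * (s * s - (1 - c) * (1 + c)))%R; last by field.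
by rewrite e subrr mulr0.
Qed.

End rotation.

(** * Reduction of integrals over balls to one dimension *)

Section coordinates.
Context {R : realType}.
Notation mu := (@lebesgue_measure R).

Lemma ge0_integral_lebesgue_RnS (d : nat) (f : Rn R d.+1 -> \bar R) :
  measurable_fun [set: _] f -> (forall x, 0 <= f x)%E ->
  (\int[lebesgue_Rn R d.+1]_x f x =
   \int[mu]_x \int[lebesgue_Rn R d]_t f (tuple_cons (x, t)))%E.
Proof.
move=> mf f0.
have mc : measurable_fun setT (@tuple_cons _ (measurableTypeR R) d).
  exact: measurable_tuple_cons.
transitivity (\int[(mu \x lebesgue_Rn R d)%E]_z (f \o tuple_cons) z)%E.
  have := @ge0_integral_pushforward _ _ _ _ R _ mc (mu \x lebesgue_Rn R d)%E
    setT f measurableT mf (fun x _ => f0 x).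
  by rewrite preimage_setT.
rewrite fubini_tonelli1//; last by move=> z; exact: f0.
apply: (measurableT_comp mf); exact: mc.
Qed.

Lemma measurable_dotp d (p : Rn R d) : measurable_fun [set: Rn R d] (dotp p).
Proof.
rewrite /dotp; apply: measurable_sum => i.
by apply: measurable_funM => //; exact: measurable_tnth.
Qed.

Lemma measurable_dotpp d : measurable_fun [set: Rn R d] (fun x => dotp x x).
Proof.
rewrite /dotp; apply: measurable_sum => i.
by apply: measurable_funM; exact: measurable_tnth.
Qed.

Lemma dotp_cons d (p : Rn R d.+1) x (t : Rn R d) :
  dotp p (tuple_cons (x, t)) = thead p * x + dotp [tuple of behead p] t.
Proof.
rewrite /dotp big_ord_recl tnth0; congr (_ + _).
apply: eq_bigr => i _; rewrite tnthS tnth_behead; congr (tnth p _ * _).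
by apply: val_inj; rewrite /= inordK // ltnS.
Qed.

Lemma dotpp_cons d x (t : Rn R d) :
  dotp (tuple_cons (x, t)) (tuple_cons (x, t)) = x ^+ 2 + dotp t t.
Proof.
rewrite /dotp big_ord_recl tnth0 expr2; congr (_ + _).
by apply: eq_bigr => i _; rewrite !tnthS.
Qed.

Lemma dotpp_ge0 d (x : Rn R d) : 0 <= dotp x x.
Proof. by apply: sumr_ge0 => i _; rewrite -expr2 sqr_ge0. Qed.

(** The parameter is the squared radius: slicing at height [x] then just subtracts [x ^+ 2], and a
    negative value gives the empty ball. *)
Definition ind_ball d (a : R) (x : Rn R d) : R := (dotp x x < a)%R%:R.

Lemma ind_ball_ge0 d a (x : Rn R d) : 0 <= ind_ball a x.
Proof. exact: ler0n. Qed.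

Lemma measurable_ind_ball d a : measurable_fun [set: Rn R d] (ind_ball a).
Proof.
rewrite (_ : ind_ball a = fun x : Rn R d => if dotp x x < a then 1 else 0); last first.
  by apply/funext => x; rewrite /ind_ball; case: ifP.
by apply: measurable_fun_ifT => //; apply: measurable_fun_ltr => //; exact: measurable_dotpp.
Qed.

Lemma ind_ball_cons d (a : R) x (t : Rn R d) :
  ind_ball a (tuple_cons (x, t)) = ind_ball (a - x ^+ 2) t.
Proof. by rewrite /ind_ball dotpp_cons ltrBrDl. Qed.

End coordinates.

(** * One-dimensional profiles of balls *)

Section radial.
Context {R : realType}.
Notation mu := (@lebesgue_measure R).

(* The [d]-th power of the square root of the positive part, except that for
   [d = 0] it vanishes on [b <= 0] (where [Num.sqrt b ^+ 0] would be 1). Up to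
   the unit-ball volume, it is the volume of the [d]-dimensional ball
   [|x|^2 < b]. *)
Definition pos_sqrtX (d : nat) (b : R) : R :=
  if 0 < b then Num.sqrt b ^+ d else 0.
Local Notation W := pos_sqrtX.

Lemma pos_sqrtX_ge0 d b : 0 <= W d b.
Proof. by rewrite /W; case: ifPn => // _; rewrite exprn_ge0// sqrtr_ge0. Qed.

Lemma pos_sqrtXM d a b : 0 < a -> W d (a * b) = Num.sqrt a ^+ d * W d b.
Proof.
move=> a0; rewrite /W pmulr_rgt0//; case: ifPn => _; last by rewrite mulr0.
by rewrite sqrtrM ?ltW// exprMn.
Qed.

Lemma measurable_pos_sqrtX d : measurable_fun [set: R] (W d).
Proof.
apply: measurable_fun_ifT => //; first exact: measurable_fun_ltr.
by apply: measurable_funX; apply: continuous_measurable_fun; exact: sqrt_continuous.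
Qed.

Lemma measurable_pos_sqrtXB d (b : R) :
  measurable_fun [set: R] (fun y => W d (b - y ^+ 2)).
Proof.
apply: (measurableT_comp (measurable_pos_sqrtX d)).
by apply: measurable_funB => //; exact: measurable_funX.
Qed.

(** The ratio of the unit-ball volumes in dimensions [d.+1] and [d]. *)
Definition pos_sqrtX_mass d : R := fine (\int[mu]_y (W d (1 - y ^+ 2))%:E)%E.

Lemma pos_sqrtX_mass_ge0 d : 0 <= pos_sqrtX_mass d.
Proof.
by apply: fine_ge0; apply: integral_ge0 => y _; rewrite lee_fin pos_sqrtX_ge0.
Qed.

Lemma pos_sqrtX_massE d : (\int[mu]_y (W d (1 - y ^+ 2))%:E)%E = (pos_sqrtX_mass d)%:E.
Proof.
rewrite /pos_sqrtX_mass fineK// ge0_fin_numE; last first.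
  by apply: integral_ge0 => y _; rewrite lee_fin pos_sqrtX_ge0.
apply: (@le_lt_trans _ _ (\int[mu]_y (\1_(`[-1, 1] : set R) y)%:E)%E).
  apply: ge0_le_integral => //.
  - by move=> y _; rewrite lee_fin pos_sqrtX_ge0.
  - by apply/measurable_EFinP; exact: measurable_pos_sqrtXB.
  - by apply/measurable_EFinP; exact: measurable_indic.
  move=> y _; rewrite lee_fin /W indicE mem_setE in_itv/=.
  case: ifPn => [y1|]; last by rewrite ler0n.
  have -> : -1 <= y <= 1 by apply/andP; split; nra.
  rewrite mulr1n exprn_ile1 ?sqrtr_ge0// -[leRHS]sqrtr1 ler_sqrt//.
  by rewrite lerBlDr lerDl sqr_ge0.
rewrite integral_indic// setIT/= lebesgue_measure_itv/= ; case: ifP => _; rewrite ?ltry // -EFinB ltry.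
Qed.

(** Substitution [y = Num.sqrt a * u]: one factor [Num.sqrt a] is the Jacobian, the other [d] come
    from the homogeneity [pos_sqrtXM]. *)
Lemma integral_pos_sqrtX_scale d (a : R) (h : R -> R) : 0 < a ->
  measurable_fun [set: R] h -> (forall x, 0 <= h x) ->
  (\int[mu]_y (h y * W d (a - y ^+ 2))%:E =
   (Num.sqrt a ^+ d.+1)%:E *
     \int[mu]_y (h (Num.sqrt a * y)%R * W d (1 - y ^+ 2))%:E)%E.
Proof.
move=> a0 mh h0.
have sa0 : 0 < Num.sqrt a by rewrite sqrtr_gt0.
have mhW : measurable_fun [set: R] (fun y => (h y * W d (a - y ^+ 2))%:E).
  apply/measurable_EFinP; apply: measurable_funM => //.
  exact: measurable_pos_sqrtXB.
have hW0 y : (0 <= (h y * W d (a - y ^+ 2))%:E)%E.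
  by rewrite lee_fin mulr_ge0// pos_sqrtX_ge0.
have := ge0_integral_affine 0 sa0 mhW hW0.
move=> /(congr1 (fun x => (Num.sqrt a)%:E * x)%E).
rewrite muleA -EFinM mulfV ?lt0r_neq0// mul1e => <-.
rewrite exprS EFinM -muleA; congr (_ * _)%E.
rewrite -ge0_integralZl//.
- apply: eq_integral => y _; rewrite -EFinM addr0; congr _%:E.
  rewrite mulrCA; congr (_ * _); rewrite -pos_sqrtXM//; congr (W d _).
  by rewrite exprMn sqr_sqrtr ?ltW// mulrBr mulr1.
- apply/measurable_EFinP; apply: measurable_funM.
    apply: (measurableT_comp mh); exact: measurable_funM.
  exact: measurable_pos_sqrtXB.
- by move=> y _; rewrite lee_fin mulr_ge0// pos_sqrtX_ge0.
Qed.

Lemma integral_pos_sqrtX d (a : R) :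
  (\int[mu]_y (W d (a - y ^+ 2))%:E)%E = (pos_sqrtX_mass d * W d.+1 a)%:E.
Proof.
have [a0|a0] := ltP 0 a; last first.
  rewrite {2}/W ltNge a0/= mulr0 integral0_eq// => y _.
  by rewrite /W ltNge subr_le0 (le_trans a0) ?sqr_ge0.
have := @integral_pos_sqrtX_scale d a (cst 1) a0 (measurable_cst _) (fun=> ler01).
under eq_integral do rewrite mul1r.
move=> ->; under eq_integral do rewrite mul1r.
by rewrite pos_sqrtX_massE /W a0 -EFinM mulrC.
Qed.

End radial.

(** * Integrals of ridge functions over balls *)

Section radial.
Context {R : realType}.
Notation mu := (@lebesgue_measure R).
Local Notation W := pos_sqrtX.

Lemma measurable_ball_ridge d (p : Rn R d) (a : R) (h : R -> R) :
  measurable_fun [set: R] h ->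
  measurable_fun [set: Rn R d]
    (fun x => (ind_ball a x * h (dotp p x))%:E).
Proof.
move=> mh; apply/measurable_EFinP; apply: measurable_funM; last first.
  by apply: (measurableT_comp mh); exact: measurable_dotp.
exact: measurable_ind_ball.
Qed.

(** Once the ridge function depends on [x] alone, integrating out [y] only raises the exponent of
    the profile by one. *)
Lemma integral_ridge_pos_sqrtX d (a u : R) (h : R -> R) :
  measurable_fun [set: R] h -> (forall x, 0 <= h x) ->
  (\int[mu]_x \int[mu]_y (h (u * x)%R * W d (a - x ^+ 2 - y ^+ 2))%:E =
   (pos_sqrtX_mass d)%:E * \int[mu]_x (h (u * x)%R * W d.+1 (a - x ^+ 2))%:E)%E.
Proof.
move=> mh h0; rewrite -ge0_integralZl//; last 3 first.
  - apply/measurable_EFinP; apply: measurable_funM.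
      by apply: (measurableT_comp mh); apply: measurable_funM.
    exact: measurable_pos_sqrtXB.
  - by move=> y _; rewrite lee_fin mulr_ge0// pos_sqrtX_ge0.
  - by rewrite lee_fin pos_sqrtX_mass_ge0.
apply: eq_integral => x _; under eq_integral do rewrite EFinM.
rewrite ge0_integralZl//.
- by rewrite integral_pos_sqrtX !EFinM muleCA.
- by apply/measurable_EFinP; exact: measurable_pos_sqrtXB.
- by move=> y _; rewrite lee_fin pos_sqrtX_ge0.
- by rewrite lee_fin.
Qed.

Lemma measurable_ridge_pos_sqrtX d (a u v : R) (h : R -> R) :
  measurable_fun [set: R] h ->
  measurable_fun [set: R * R] (fun z : R * R =>
    (h (u * z.1 + v * z.2) * W d (a - z.1 ^+ 2 - z.2 ^+ 2))%:E).
Proof.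
move=> mh; apply/measurable_EFinP; apply: measurable_funM.
  apply: (measurableT_comp mh).
  by apply: measurable_funD; apply: measurable_funM.
apply: (measurableT_comp (measurable_pos_sqrtX d)).
by apply: measurable_funB; [apply: measurable_funB => //|]; exact: measurable_funX.
Qed.

(* Only [m ^+ 2] is specified: fixing the sign of [m] would take a reflection
   when the first coordinate of [p] is the only nonzero one. *)
Lemma integral_ball_ridge d : exists2 c : R, 0 <= c &
  forall p : Rn R d.+1, exists2 m : R, m ^+ 2 = dotp p p &
  forall (a : R) (h : R -> R),
    measurable_fun [set: R] h -> (forall x, 0 <= h x) ->
    (\int[lebesgue_Rn R d.+1]_x (ind_ball a x * h (dotp p x))%:E =
     c%:E * \int[mu]_t (h (m * t)%R * W d (a - t ^+ 2))%:E)%E.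
Proof.
elim: d => [|d [c c0 IH]].
  exists 1 => // p; exists (thead p).
    by rewrite /dotp big_ord_recl big_ord0 addr0 expr2.
  move=> a h mh h0; rewrite mul1e ge0_integral_lebesgue_RnS; last 2 first.
  - exact: measurable_ball_ridge.
  - by move=> x; rewrite lee_fin mulr_ge0// ind_ball_ge0.
  apply: eq_integral => x _ /=.
  rewrite integral_dirac//=; last first.
    apply: (measurableT_comp (measurable_ball_ridge p a mh)).
    exact: (measurableT_comp (@measurable_tuple_cons _ (measurableTypeR R) 0) (pair1_measurable x)).
  rewrite diracT mul1e ind_ball_cons dotp_cons /ind_ball /dotp !big_ord0 addr0.
  (* The point mass leaves the indicator of [0 < a - x ^+ 2]; the convention for [pos_sqrtX 0] is
     made for this. *)
  by rewrite /W expr0 mulrC; case: ifP.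
exists (c * pos_sqrtX_mass d); first by rewrite mulr_ge0// pos_sqrtX_mass_ge0.
move=> p; have [m mp {}IH] := IH [tuple of behead p].
have pE : dotp p p = thead p ^+ 2 + dotp [tuple of behead p] [tuple of behead p].
  by rewrite -dotpp_cons; congr (dotp _ _); rewrite /tuple_cons/=; apply/val_inj;
    rewrite /= ; case: p {IH mp} => -[].
(* For a fixed first coordinate [x], the induction hypothesis applies to the tail of [p] with the
   shifted function [h (thead p * x + _)] and squared radius [a - x ^+ 2]. What is left is planar,
   with direction [(thead p, m)]. *)
have step (a : R) (h : R -> R) : measurable_fun [set: R] h -> (forall x, 0 <= h x) ->
    (\int[lebesgue_Rn R d.+2]_x (ind_ball a x * h (dotp p x))%:E =
     c%:E * \int[mu]_x \int[mu]_y
       (h (thead p * x + m * y)%R * W d (a - x ^+ 2 - y ^+ 2))%:E)%E.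
  move=> mh h0; rewrite ge0_integral_lebesgue_RnS; last 2 first.
  - exact: measurable_ball_ridge.
  - by move=> x; rewrite lee_fin mulr_ge0// ind_ball_ge0.
  rewrite -ge0_integralZl//.
  - apply: eq_integral => x _.
    rewrite -(IH (a - x ^+ 2) (fun z => h (thead p * x + z)))//; last first.
      by apply: (measurableT_comp mh); exact: measurable_funD.
    apply: eq_integral => t _.
    by rewrite dotp_cons ind_ball_cons.
  - apply: (measurable_fun_fubini_tonelli_F (m2 := mu) (fun z : R * R =>
      (h (thead p * z.1 + m * z.2) * W d (a - z.1 ^+ 2 - z.2 ^+ 2))%:E)).
      exact: measurable_ridge_pos_sqrtX.
    by move=> z; rewrite lee_fin mulr_ge0// pos_sqrtX_ge0.
  - by move=> x _; apply: integral_ge0 => y _; rewrite lee_fin mulr_ge0// pos_sqrtX_ge0.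
(* If [m = 0], the direction already lies along the first axis, and the rotation below would have
   sine 0, which [ge0_integral_rotation] excludes. *)
have [m0|m0] := eqVneq m 0.
  exists (thead p); first by rewrite pE -mp m0 expr0n addr0.
  move=> a h mh h0; rewrite step// m0.
  under eq_integral do under eq_integral do rewrite mul0r addr0.
  by rewrite integral_ridge_pos_sqrtX// muleA -EFinM.
have p0 : 0 < dotp p p.
  by rewrite pE -mp ltr_wpDl ?sqr_ge0// exprn_even_gt0.
pose l := Num.sqrt (dotp p p).
have l0 : l != 0 by rewrite lt0r_neq0// sqrtr_gt0.
have l2 : l ^+ 2 = dotp p p by rewrite sqr_sqrtr// ltW.
exists l => // a h mh h0; rewrite step//.
(* [K] is the integrand after alignment with the first axis; composed with the rotation of cosine
   [thead p / l] and sine [m / l] it is the integrand of [step]. *)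
pose K (z : R * R) := (h (l * z.1 + 0 * z.2) * W d (a - z.1 ^+ 2 - z.2 ^+ 2))%:E.
have mK : measurable_fun setT K by exact: measurable_ridge_pos_sqrtX.
have K0 z : (0 <= K z)%E by rewrite lee_fin mulr_ge0// pos_sqrtX_ge0.
have s0 : m / l != 0 by rewrite mulf_neq0// invr_eq0.
have cs : (thead p / l) ^+ 2 + (m / l) ^+ 2 = 1.
  by rewrite !expr_div_n -mulrDl mp -pE -l2 divff// expf_neq0.
have := ge0_integral_rotation mK K0 s0 cs.
rewrite (_ : (\int[mu]_x \int[mu]_y K (x, y) = \int[mu]_x \int[mu]_y
    (h (l * x)%R * W d (a - x ^+ 2 - y ^+ 2))%:E)%E); last first.
  by apply: eq_integral => x _; apply: eq_integral => y _;
    rewrite /K/= mul0r addr0.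
rewrite integral_ridge_pos_sqrtX// => H; transitivity (c%:E * ((pos_sqrtX_mass d)%:E *
    \int[mu]_x (h (l * x)%R * W d.+1 (a - x ^+ 2))%:E))%E; last first.
  by rewrite muleA -EFinM.
congr (_ * _)%E; rewrite -[RHS]H.
apply: eq_integral => x _; apply: eq_integral => y _.
rewrite /K/=; congr ((h _ * W d _)%:E); first by field.
transitivity (a - (x ^+ 2 + y ^+ 2) * ((thead p / l) ^+ 2 + (m / l) ^+ 2)).
  by rewrite cs mulr1 opprD addrA.
ring.
Qed.

End radial.

(** * Oscillatory integrals *)

Section by_parts.
Context {R : realType}.
Notation mu := (@lebesgue_measure R).
Implicit Types (a b l th t : R) (f F : R -> R) (q : {poly R}) (k : nat).

Lemma Rintegral_le_bound a b f (M : R) : a <= b ->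
  {within `[a, b], continuous f} ->
  (forall t, t \in `[a, b] -> `|f t| <= M) ->
  `|\int[mu]_(t in `[a, b]) f t| <= M * (b - a).
Proof.
move=> ab cf fM.
have If : mu.-integrable `[a, b] (EFin \o f).
  by apply: continuous_compact_integrable => //; exact: segment_compact.
have IM : mu.-integrable `[a, b] (EFin \o cst M).
  apply: continuous_compact_integrable; first exact: segment_compact.
  by apply: continuous_subspaceT => x; exact: cvg_cst.
apply: (le_trans (le_normr_Rintegral _ If)) => //.
have Inf : mu.-integrable `[a, b] (EFin \o (fun t => `|f t|)).
  have := integrable_norm If; exact.
apply: (le_trans (le_Rintegral _ Inf IM _)) => //.
rewrite Rintegral_cst//= lebesgue_measure_itv/= lte_fin.
have [ab'|ba] := ltP a b; first by rewrite -EFinB.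
by rewrite mulr0 mulr_ge0// ?subr_ge0//; have := fM a;
  rewrite in_itv/= lexx ab => /(_ isT); exact: le_trans.
Qed.

Lemma is_derive_continuous F f t : is_derive t 1 F (f t) -> {for t, continuous F}.
Proof.
by move=> H; apply/differentiable_continuous/derivable1_diffP; case: H.
Qed.

Lemma derivable_oo_LRcontinuousP F f a b : a < b ->
  {in `]a, b[, forall t, is_derive t 1 F (f t)} ->
  {for a, continuous F} -> {for b, continuous F} ->
  derivable_oo_LRcontinuous F a b /\ {in `]a, b[, F^`()%classic =1 f}.
Proof.
move=> ab dF ca cb; split; first split.
- by move=> t /dF [].
- exact: cvg_at_right_filter.
- exact: cvg_at_left_filter.
- by move=> t /dF [_ <-]; rewrite derive1E.
Qed.

Lemma is_derive_sin_affine l th t :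
  is_derive t 1 (fun x => sin (l * x + th)) (l * cos (l * t + th)).
Proof.
have H : is_derive t 1 (fun x => l * x + th) l.
  apply: (@is_derive_eq _ _ _ (l \*: id + cst th)).
  by rewrite /GRing.scale/= mulr1 addr0.
apply: (@is_derive_eq _ _ _ (sin \o (fun x => l * x + th))).
by rewrite mulrC.
Qed.

Lemma continuous_cos_affine l th : continuous (fun x => cos (l * x + th)).
Proof.
move=> x; apply: (@continuous_comp _ _ _ (fun x => l * x + th) cos).
  by apply: cvgD; [apply: cvgM; [exact: cvg_cst|exact: cvg_id]|exact: cvg_cst].
exact: continuous_cos.
Qed.

(** The sine produced by integrating the cosine is written as a cosine of shifted phase, so that the
    estimate can be iterated. Differentiability is asked only in the interior because [hcirc] has
    vertical tangents at -1 and 1. *)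
Lemma osc_by_parts F f a b l th : a < b -> 0 < l ->
  {in `]a, b[, forall t, is_derive t 1 F (f t)} ->
  {for a, continuous F} -> {for b, continuous F} ->
  {within `[a, b], continuous f} ->
  `|\int[mu]_(t in `[a, b]) (F t * cos (l * t + th))| <=
  l^-1 * (`|F a| + `|F b| +
    `|\int[mu]_(t in `[a, b]) (f t * cos (l * t + (th - pi / 2)))|).
Proof.
move=> ab l0 dF ca cb cf.
have [dF1 dF2] := derivable_oo_LRcontinuousP ab dF ca cb.
pose G t := l^-1 * sin (l * t + th).
have dG t : is_derive t 1 G (cos (l * t + th)).
  have H := is_derive_sin_affine l th t.
  apply: (@is_derive_eq _ _ _ (l^-1 \*: (fun x => sin (l * x + th)))).
  by rewrite /GRing.scale/= mulrA mulVf ?mul1r// lt0r_neq0.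
have cG t : {for t, continuous G}.
  exact: (@is_derive_continuous G (fun t => cos (l * t + th))).
have [dG1 dG2] := @derivable_oo_LRcontinuousP G _ a b ab (fun t _ => dG t) (cG a) (cG b).
rewrite (Rintegration_by_parts ab cf dF1 dF2 _ dG1 dG2); last first.
  by apply: continuous_subspaceT; exact: continuous_cos_affine.
have -> : \int[mu]_(x in `[a, b]) (f x * G x) =
    l^-1 * \int[mu]_(t in `[a, b]) (f t * cos (l * t + (th - pi / 2))).
  rewrite -RintegralZl//.
    apply: eq_Rintegral => x _; rewrite /G mulrCA; congr (_ * (_ * _)).
    by rewrite addrA cosBpihalf.
  apply: continuous_compact_integrable; first exact: segment_compact.
  move=> x; apply: cvgM; first exact: cf.
  by apply: continuous_subspaceT; exact: continuous_cos_affine.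
apply: (le_trans (ler_normB _ _)).
rewrite normrM gtr0_norm ?invr_gt0// mulrDr lerD2r.
apply: (le_trans (ler_normB _ _)).
rewrite /G !normrM (gtr0_norm (_ : 0 < l^-1)) ?invr_gt0//.
have s1 (x : R) : `|sin x| <= 1 by rewrite ler_norml sin_geN1 sin_le1.
have ? : 0 <= l^-1 by rewrite invr_ge0 ltW.
rewrite addrC mulrDr; apply: lerD; rewrite mulrCA ler_wpM2l// ler_piMr//; exact: s1.
Qed.

Definition pnorm q : R := \sum_(i < size q) `|q`_i|.

Lemma pnorm_ge0 q : 0 <= pnorm q.
Proof. exact: sumr_ge0. Qed.

Lemma horner_le_pnorm q t : `|t| <= 1 -> `|q.[t]| <= pnorm q.
Proof.
move=> t1; rewrite horner_coef; apply: (le_trans (ler_norm_sum _ _ _)).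
by apply: ler_sum => i _; rewrite normrM ler_piMr// normrX exprn_ile1.
Qed.

(** The square root of a negative number is 0, so this is continuous on the whole line. *)
Definition hcirc t : R := Num.sqrt (1 - t ^+ 2).
Local Notation w := hcirc.

Lemma hcirc_ge0 t : 0 <= w t. Proof. exact: sqrtr_ge0. Qed.

Lemma hcirc_le1 t : w t <= 1.
Proof. by rewrite -[leRHS]sqrtr1 ler_wsqrtr// lerBlDr lerDl sqr_ge0. Qed.

Lemma hcirc_gt0 t : -1 < t < 1 -> 0 < w t.
Proof. by move=> /andP[? ?]; rewrite sqrtr_gt0; nra. Qed.

Lemma sqr_hcirc t : -1 <= t <= 1 -> w t ^+ 2 = 1 - t ^+ 2.
Proof. by move=> /andP[? ?]; rewrite sqr_sqrtr//; nra. Qed.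

Lemma continuous_hcirc : continuous w.
Proof.
move=> x; apply: (@continuous_comp R R R (fun x => 1 - x ^+ 2) (@Num.sqrt R)).
  by apply: cvgB; [exact: cvg_cst|exact: exprn_continuous].
exact: sqrt_continuous.
Qed.

Lemma is_derive_hcirc t : -1 < t < 1 -> is_derive t 1 w (- t / w t).
Proof.
move=> t1; have w0 := hcirc_gt0 t1.
have H : is_derive t 1 (fun x => 1 - x ^+ 2) (- (2 * t)).
  rewrite (_ : (fun x => _) = horner (1 - 'X^2)); last first.
    by apply/funext => x; rewrite !hornerE.
  apply: is_derive_eq.
  by rewrite derivB derivC derivXn !hornerE/= ?sub0r mulr_natl.
have : 0 < 1 - t ^+ 2 by rewrite -sqrtr_gt0.
move=> /is_derive1_sqrt H2.
apply: (@is_derive_eq _ _ _ (Num.sqrt \o (fun x => 1 - x ^+ 2))).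
by rewrite -/(w t); field; exact: lt0r_neq0.
Qed.

(** The case of interest is [q = 1]; a general polynomial is carried along because each integration
    by parts changes it. *)
Definition osc q k l th : R :=
  \int[mu]_(t in `[-1, 1]) (q.[t] * w t ^+ k * cos (l * t + th)).

Lemma continuous_horner_hcircX q k : continuous (fun t => q.[t] * w t ^+ k).
Proof.
move=> t; apply: cvgM; first exact: continuous_horner.
apply: (@continuous_comp R R R w (fun x => x ^+ k)); first exact: continuous_hcirc.
exact: exprn_continuous.
Qed.

Lemma horner_hcircX_le q k t : t \in `[-1, 1] -> `|q.[t] * w t ^+ k| <= pnorm q.
Proof.
rewrite in_itv/= => t1; rewrite normrM; apply: (le_trans (_ : _ <= `|q.[t]|)).
  rewrite ler_piMr// ger0_norm ?exprn_ge0 ?hcirc_ge0//.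
  by rewrite exprn_ile1 ?hcirc_ge0// hcirc_le1.
by apply: horner_le_pnorm; rewrite ler_norml.
Qed.

Lemma cos_le1_norm (x : R) : `|cos x| <= 1.
Proof. by rewrite ler_norml cos_geN1 cos_le1. Qed.

Lemma osc_le q k l th : `|osc q k l th| <= pnorm q * 2.
Proof.
have -> : 2 = 1 - (-1) :> R by rewrite opprK.
apply: Rintegral_le_bound => //.
- apply: continuous_subspaceT => t.
  by apply: cvgM; [exact: continuous_horner_hcircX|exact: continuous_cos_affine].
- move=> t t1; rewrite normrM; apply: le_trans (horner_hcircX_le q k t1).
  by rewrite ler_piMr// cos_le1_norm.
Qed.

(* [(q w^k)' = osc_deriv k q * w^(k-2)] for [w = hcirc]. *)
Definition osc_deriv k q : {poly R} :=
  q^`() * (1 - 'X^2) - k%:R *: ('X * q).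

Lemma is_derive_horner_hcircX q k t : -1 < t < 1 ->
  is_derive t 1 (fun t => q.[t] * w t ^+ k.+2)
    ((osc_deriv k.+2 q).[t] * w t ^+ k).
Proof.
move=> t1; have dw := is_derive_hcirc t1.
have w0 : w t != 0 by rewrite lt0r_neq0// hcirc_gt0.
have w2 : w t ^+ 2 = 1 - t ^+ 2.
  by apply: sqr_hcirc; case/andP: t1 => /ltW -> /ltW ->.
rewrite (_ : (fun t => _) = horner q * w ^+ k.+2); last first.
  by apply/funext => x; rewrite !fctE.
apply: is_derive_eq.
rewrite /osc_deriv /GRing.scale/= !hornerE -w2 fctE !exprS.
rewrite expr0 /=; by field.
Qed.

(** The boundary terms vanish since [hcirc] is 0 at -1 and 1 and occurs with a positive exponent. *)
Lemma osc_step q k l th : 0 < l ->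
  `|osc q k.+2 l th| <= l^-1 * `|osc (osc_deriv k.+2 q) k l (th - pi / 2)|.
Proof.
move=> l0; have N11 : -1 < 1 :> R by lra.
have := @osc_by_parts (fun t => q.[t] * w t ^+ k.+2)
  (fun t => (osc_deriv k.+2 q).[t] * w t ^+ k) (-1) 1 l th N11 l0.
rewrite /= [in w (-1)]/w [in w 1]/w sqrrN expr1n subrr sqrtr0 !expr0n/= !mulr0 normr0 !add0r.
apply.
- by move=> t; rewrite in_itv/=; exact: is_derive_horner_hcircX.
- exact: continuous_horner_hcircX.
- exact: continuous_horner_hcircX.
- exact/continuous_subspaceT/continuous_horner_hcircX.
Qed.

(** Here the boundary terms survive, and their order [l^-1] is exactly the rate expected for
    exponent 0. *)
Lemma osc0_le q l th : 0 < l ->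
  `|osc q 0 l th| <= l^-1 * (pnorm q * 2 + pnorm q^`() * 2).
Proof.
move=> l0; have N11 : -1 < 1 :> R by lra.
have E p x : osc p 0 l x = \int[mu]_(t in `[-1, 1]) (p.[t] * cos (l * t + x)).
  by apply: eq_Rintegral => t _; rewrite expr0 mulr1.
rewrite E; apply: (le_trans (@osc_by_parts (horner q) (horner q^`())
  (-1) 1 l th N11 l0 _ _ _ _)).
- by move=> t _; exact: is_derive_poly.
- exact: continuous_horner.
- exact: continuous_horner.
- exact/continuous_subspaceT/continuous_horner.
rewrite -E; apply: ler_wpM2l; first by rewrite invr_ge0 ltW.
apply: lerD; last exact: osc_le.
by rewrite mulr_natr mulr2n; apply: lerD; rewrite horner_le_pnorm// ?normrN normr1.
Qed.

End by_parts.

(** * Negative powers of the half circle *)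

Section half_circle.
Context {R : realType}.
Notation mu := (@lebesgue_measure R).
Implicit Types (a b l th t : R) (f F : R -> R) (q : {poly R}) (k : nat).
Local Notation w := hcirc.

Lemma Rintegral_split a b c f : a <= b -> b <= c ->
  {within `[a, c], continuous f} ->
  \int[mu]_(t in `[a, c]) f t =
  \int[mu]_(t in `[a, b]) f t + \int[mu]_(t in `[b, c]) f t.
Proof.
move=> ab bc cf.
have If : mu.-integrable `[a, c] (EFin \o f).
  by apply: continuous_compact_integrable => //; exact: segment_compact.
have := Rintegral_itvB If (_ : (BLeft a <= BRight b)%O) (_ : (BRight b <= BRight c)%O).
rewrite !bnd_simp => /(_ ab bc) /(canRL (subrK _)) ->; rewrite addrC; congr (_ + _).
rewrite -Rintegral_itv_obnd_cbnd//.
apply: (integrableS _ _ _ If) => //.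
by apply: subset_itv; rewrite bnd_simp.
Qed.

Lemma is_derive_horner_hcirc q t : -1 < t < 1 ->
  is_derive t 1 (fun t => q.[t] * w t) ((osc_deriv 1 q).[t] / w t).
Proof.
move=> t1; have dw := is_derive_hcirc t1.
have w0 : w t != 0 by rewrite lt0r_neq0// hcirc_gt0.
have w2 : w t ^+ 2 = 1 - t ^+ 2.
  by apply: sqr_hcirc; case/andP: t1 => /ltW -> /ltW ->.
apply: (@is_derive_eq _ _ _ (horner q * w)).
rewrite /osc_deriv /GRing.scale/= !hornerE -w2 /=.
by field.
Qed.

(* The analogue of [osc_deriv k] for [k = -1]. *)
Definition osc_derivN q : {poly R} := q^`() * (1 - 'X^2) + 'X * q.

Lemma is_derive_horner_div_hcirc q t : -1 < t < 1 ->
  is_derive t 1 (fun t => q.[t] / w t) ((osc_derivN q).[t] / w t ^+ 3).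
Proof.
move=> t1; have dw := is_derive_hcirc t1.
have w0 : w t != 0 by rewrite lt0r_neq0// hcirc_gt0.
have w2 : w t ^+ 2 = 1 - t ^+ 2.
  by apply: sqr_hcirc; case/andP: t1 => /ltW -> /ltW ->.
have dV := is_deriveV w0 dw.
apply: (@is_derive_eq _ _ _ (horner q * (fun t => (w t)^-1))).
rewrite /osc_derivN /GRing.scale/= !hornerE -w2 /=.
by field.
Qed.

Lemma within_continuous_div_hcircX q k a : 0 <= a < 1 ->
  {within `[- a, a], continuous (fun t => q.[t] / w t ^+ k)}.
Proof.
move=> /andP[a0 a1]; apply: continuous_in_subspaceT => t.
rewrite inE/= in_itv/= => /andP[at1 at2].
apply: cvgM; first exact: continuous_horner.
apply: cvgV; first by rewrite expf_neq0// lt0r_neq0// hcirc_gt0//; apply/andP; split; lra.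
apply: (@continuous_comp R R R w (fun x => x ^+ k)); first exact: continuous_hcirc.
exact: exprn_continuous.
Qed.

(* [t / w t] is an antiderivative of [w t ^- 3]. *)
Lemma Rintegral_hcircN3 a : 0 < a < 1 ->
  \int[mu]_(t in `[- a, a]) (w t ^+ 3)^-1 = 2 * (a / w a).
Proof.
move=> /andP[a0 a1].
have aa : - a < a by lra.
have aN1 t : t \in `[- a, a] -> -1 < t < 1.
  by rewrite in_itv/= => /andP[? ?]; apply/andP; split; lra.
have E : osc_derivN 'X = 1 :> {poly R}.
  by rewrite /osc_derivN derivX mul1r -expr2 subrK.
have dF t : -1 < t < 1 -> is_derive t 1 (fun t => t / w t) (w t ^+ 3)^-1.
  move=> /(is_derive_horner_div_hcirc 'X); rewrite E hornerC mul1r.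
  by under eq_fun do rewrite hornerX.
have [H1 H2] : derivable_oo_LRcontinuous (fun t => t / w t) (- a) a /\
    {in `]- a, a[, (fun t => t / w t)^`()%classic =1 (fun t => (w t ^+ 3)^-1)}.
  apply: derivable_oo_LRcontinuousP => //.
  - by move=> t ta; apply/dF/aN1/subset_itv_oo_cc.
  - by apply: (@is_derive_continuous R _ (fun t => (w t ^+ 3)^-1)); apply/dF/aN1; rewrite in_itv/= lexx ltW.
  - by apply: (@is_derive_continuous R _ (fun t => (w t ^+ 3)^-1)); apply/dF/aN1; rewrite in_itv/= lexx ltW.
have cf : {within `[- a, a], continuous (fun t => (w t ^+ 3)^-1)}.
  rewrite (_ : (fun t => _) = (fun t => (1 : {poly R}).[t] / w t ^+ 3)).
    by apply: within_continuous_div_hcircX; rewrite a1 ltW.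
  by apply/funext => t; rewrite hornerE mul1r.
rewrite /Rintegral (continuous_FTC2 aa cf H1 H2) -EFinB /= /w sqrrN; lra.
Qed.

End half_circle.

(** * Decay rates of the half-circle integrals *)

Section decay.
Context {R : realType}.
Notation mu := (@lebesgue_measure R).
Implicit Types (a b l th t : R) (f F : R -> R) (q : {poly R}) (k : nat).
Local Notation w := hcirc.

(** The weight is integrated exactly: for [a = 1 - l^-1] the bound has order [Num.sqrt l], while the
    supremum of [hcirc t ^- 3] would cost [l * Num.sqrt l]. *)
Lemma Rintegral_div_hcircN3_le q a l th : 0 < a < 1 ->
  `|\int[mu]_(t in `[- a, a]) (q.[t] / w t ^+ 3 * cos (l * t + th))| <=
  pnorm q * (2 * (a / w a)).
Proof.
move=> a01; have /andP[a0 a1] := a01.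
have cc f : {within `[- a, a], continuous f} ->
    mu.-integrable `[- a, a] (EFin \o f).
  by apply: continuous_compact_integrable; exact: segment_compact.
have c1 : {within `[- a, a], continuous (fun t => q.[t] / w t ^+ 3)}.
  by apply: within_continuous_div_hcircX; rewrite a1 ltW.
have c2 : {within `[- a, a], continuous (fun t => (w t ^+ 3)^-1)}.
  rewrite (_ : (fun t => _) = (fun t => (1 : {poly R}).[t] / w t ^+ 3)).
    by apply: within_continuous_div_hcircX; rewrite a1 ltW.
  by apply/funext => t; rewrite hornerE mul1r.
have I1 : mu.-integrable `[- a, a]
    (EFin \o (fun t => q.[t] / w t ^+ 3 * cos (l * t + th))).
  apply: cc => t; apply: cvgM; first exact: c1.
  by apply: continuous_subspaceT; exact: continuous_cos_affine.
have I2 := cc _ c2.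
apply: (le_trans (le_normr_Rintegral _ I1)) => //.
rewrite -Rintegral_hcircN3// -RintegralZl//.
apply: le_Rintegral => //.
- exact: (integrable_norm I1).
- by apply: cc => t; apply: cvgM; [exact: cvg_cst|exact: c2].
move=> t; rewrite /= in_itv/= => /andP[t1 t2].
have w3 : 0 <= (w t ^+ 3)^-1 by rewrite invr_ge0 exprn_ge0// hcirc_ge0.
rewrite normrM -[leRHS]mulr1; apply: ler_pM => //; last exact: cos_le1_norm.
rewrite normrM (ger0_norm w3) ler_wpM2r// horner_le_pnorm//.
by rewrite ler_norml; apply/andP; split; lra.
Qed.

(* Integrating by parts twice is only possible away from the endpoints, where the
   second derivative of [q * hcirc] is not integrable: the intervals of length
   [l^-1] at both ends are estimated trivially. *)
Lemma osc1_le_large q l th : 2 < l ->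
  `|osc q 1 l th| <= l^-1 * (Num.sqrt l)^-1 *
    (8 * pnorm q + 2 * pnorm (osc_deriv 1 q) + 2 * pnorm (osc_derivN (osc_deriv 1 q))).
Proof.
move=> l2; have l0 : 0 < l by lra.
pose s := Num.sqrt l; have s0 : 0 < s by rewrite sqrtr_gt0.
have sl : s ^+ 2 = l by rewrite sqr_sqrtr// ltW.
have li : 0 < l^-1 by rewrite invr_gt0.
have li2 : l^-1 < 2^-1 by rewrite ltf_pV2 ?posrE.
pose a := 1 - l^-1.
have a0 : 0 < a by rewrite /a; lra.
have a1 : a < 1 by rewrite /a; lra.
have a01 : 0 < a < 1 by rewrite a0 a1.
have si0 : 0 < s^-1 by rewrite invr_gt0.
have si2 : s^-1 ^+ 2 = l^-1 by rewrite exprVn sl.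
(* Since [1 - a ^+ 2 = 2 * l^-1 - l^-1 ^+ 2] lies between [l^-1] and [4 * l^-1], the half circle is
   at most [2 * s^-1] on the end pieces and at least [s^-1] at [a]. *)
have wle t : a <= `|t| -> w t <= 2 * s^-1.
  have r0 : 0 <= 2 * s^-1 by lra.
  move=> ta; rewrite -(ger0_norm r0).
  rewrite -sqrtr_sqr /hcirc ler_wsqrtr// exprMn si2 -real_normK ?num_real//.
  have : a ^+ 2 <= `|t| ^+ 2.
    by rewrite ler_sqr// nnegrE ltW.
  rewrite /a; nra.
have wge : s^-1 <= w a.
  rewrite -[leLHS](gtr0_norm si0) -sqrtr_sqr /hcirc ler_wsqrtr// si2 /a; nra.
have N0 := pnorm_ge0 q.
pose Q := osc_deriv 1 q; pose Q2 := osc_derivN Q.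
pose f t := q.[t] * w t ^+ 1 * cos (l * t + th).
have cf : continuous f.
  by move=> t; apply: cvgM; [exact: continuous_horner_hcircX|exact: continuous_cos_affine].
have aN : - 1 <= - a by lra.
(* An end piece has length [l^-1] and an integrand of order [s^-1], which is already the rate
   [l^(-3/2)]. *)
have ends b : -1 <= b -> b + l^-1 <= 1 -> (forall t, t \in `[b, b + l^-1] -> a <= `|t|) ->
    `|\int[mu]_(t in `[b, b + l^-1]) f t| <= pnorm q * (2 * s^-1) * l^-1.
  move=> b1 b2 H; have -> : l^-1 = b + l^-1 - b by rewrite addrAC subrr add0r.
  rewrite [b + (_ - b)]addrCA subrr addr0 in H *.
  apply: Rintegral_le_bound; [lra|exact: continuous_subspaceT|].
  move=> t tb; have := H t tb => ta; move: tb; rewrite in_itv/= => /andP[t1 t2].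
  rewrite /f expr1 normrM -[leRHS]mulr1; apply: ler_pM => //; last exact: cos_le1_norm.
  rewrite normrM; apply: ler_pM => //.
    by apply: horner_le_pnorm; rewrite ler_norml; apply/andP; split; lra.
  by rewrite ger0_norm ?hcirc_ge0//; exact: wle.
have aa : - a < a by lra.
have ta1 t : t \in `[- a, a] -> -1 < t < 1.
  by rewrite in_itv/= => /andP[? ?]; apply/andP; split; lra.
have waN : w (- a) = w a by rewrite /hcirc sqrrN.
have w0 : 0 < w a by apply: lt_le_trans wge.
(* Both boundary terms and the remaining integral have order [s], so the second integration by parts
   gains [l^-1 * s = s^-1] in total. *)
have mid2 x : `|\int[mu]_(t in `[- a, a]) (Q.[t] / w t * cos (l * t + x))| <=
    l^-1 * (pnorm Q * s + pnorm Q * s + pnorm Q2 * (2 * s)).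
  apply: (le_trans (@osc_by_parts R (fun t => Q.[t] / w t)
    (fun t => Q2.[t] / w t ^+ 3) (- a) a l x aa l0 _ _ _ _)).
  - by move=> t /(@subset_itv_oo_cc _ _ _ _) /ta1; exact: is_derive_horner_div_hcirc.
  - by apply: (@is_derive_continuous R _ (fun t => Q2.[t] / w t ^+ 3));
      apply/is_derive_horner_div_hcirc/ta1; rewrite in_itv/= lexx ltW.
  - by apply: (@is_derive_continuous R _ (fun t => Q2.[t] / w t ^+ 3));
      apply/is_derive_horner_div_hcirc/ta1; rewrite in_itv/= lexx ltW.
  - by apply: within_continuous_div_hcircX; rewrite a1 ltW.
  apply: ler_wpM2l; first exact: ltW.
  have bd : forall t, `|t| <= 1 -> w t = w a -> `|Q.[t] / w t| <= pnorm Q * s.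
    move=> t t1 ->; rewrite normrM; apply: ler_pM => //; first exact: horner_le_pnorm.
    by rewrite ger0_norm ?invr_ge0 ?hcirc_ge0// -[leRHS]invrK lef_pV2.
  apply: lerD; first apply: lerD.
  - by apply: bd; rewrite // normrN ger0_norm ltW.
  - by apply: bd; rewrite // ger0_norm ltW.
  apply: (le_trans (Rintegral_div_hcircN3_le _ _ _ a01)).
  apply: ler_wpM2l; first exact: pnorm_ge0.
  apply: ler_wpM2l => //; rewrite -[leRHS]mul1r; apply: ler_pM => //; [exact: ltW|by rewrite invr_ge0 ltW|exact: ltW|].
  by rewrite -[leRHS]invrK lef_pV2.
have mid : `|\int[mu]_(t in `[- a, a]) f t| <=
   l^-1 * (pnorm q * (2 * s^-1) + pnorm q * (2 * s^-1) +
     l^-1 * (pnorm Q * s + pnorm Q * s + pnorm Q2 * (2 * s))).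
  rewrite /f; under eq_Rintegral do rewrite expr1.
  apply: (le_trans (@osc_by_parts R (fun t => q.[t] * w t)
    (fun t => Q.[t] / w t) (- a) a l th aa l0 _ _ _ _)).
  - by move=> t /(@subset_itv_oo_cc _ _ _ _) /ta1; exact: is_derive_horner_hcirc.
  - by apply: (@is_derive_continuous R _ (fun t => Q.[t] / w t));
      apply/is_derive_horner_hcirc/ta1; rewrite in_itv/= lexx ltW.
  - by apply: (@is_derive_continuous R _ (fun t => Q.[t] / w t));
      apply/is_derive_horner_hcirc/ta1; rewrite in_itv/= lexx ltW.
  - rewrite (_ : (fun t => _) = (fun t => Q.[t] / w t ^+ 1)).
      by apply: within_continuous_div_hcircX; rewrite a1 ltW.
    by apply/funext => t; rewrite expr1.
  apply: ler_wpM2l; first exact: ltW.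
  have bd : forall t, `|t| = a -> `|q.[t] * w t| <= pnorm q * (2 * s^-1).
    move=> t ta; rewrite normrM; apply: ler_pM => //.
      by apply: horner_le_pnorm; rewrite ta ltW.
    by rewrite ger0_norm ?hcirc_ge0// wle// ta.
  apply: lerD; last exact: mid2.
  by apply: lerD; apply: bd; rewrite ?normrN gtr0_norm.
have ls : l^-1 * s = s^-1 by rewrite -sl expr2 invfM -mulrA mulVf ?mulr1// lt0r_neq0.
rewrite /osc (@Rintegral_split R _ (- a) _ f)//; [|lra|exact: continuous_subspaceT].
rewrite (@Rintegral_split R _ a _ f)//; [|lra|lra|exact: continuous_subspaceT].
apply: (le_trans (ler_normD _ _)); apply: (le_trans (lerD (lexx _) (ler_normD _ _))).
have e1 := ends (-1) (lexx _); have e2 := ends a.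
have E1 : -1 + l^-1 = - a by rewrite /a; lra.
have E2 : a + l^-1 = 1 by rewrite /a; lra.
rewrite E1 in e1; rewrite E2 in e2.
have {}e1 : `|\int[mu]_(t in `[-1, - a]) f t| <= pnorm q * (2 * s^-1) * l^-1.
  apply: e1; first lra.
  by move=> t; rewrite in_itv/= => /andP[_ ?]; rewrite ler0_norm; lra.
have {}e2 : `|\int[mu]_(t in `[a, 1]) f t| <= pnorm q * (2 * s^-1) * l^-1.
  apply: e2; [lra|lra|].
  by move=> t; rewrite in_itv/= => /andP[? _]; rewrite ger0_norm; lra.
rewrite mulrA in mid.
(* The 8 collects [2 * pnorm q] from each of the two end pieces and each of the two boundary terms
   of the first integration by parts. *)
have -> : l^-1 * s^-1 * (8 * pnorm q + 2 * pnorm Q + 2 * pnorm Q2) =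
  pnorm q * (2 * s^-1) * l^-1 + (l^-1 * (pnorm q * (2 * s^-1) + pnorm q * (2 * s^-1) +
     (pnorm Q * (l^-1 * s) + pnorm Q * (l^-1 * s) + pnorm Q2 * (2 * (l^-1 * s)))) +
  pnorm q * (2 * s^-1) * l^-1).
  by rewrite ls; ring.
apply: lerD => //; apply: lerD => //; apply: (le_trans mid).
by rewrite le_eqVlt; apply/orP; left; apply/eqP; ring.
Qed.

Lemma osc1_le q : exists2 C : R, 0 <= C &
  forall l th, 0 < l -> `|osc q 1 l th| <= C * (Num.sqrt l)^-1 ^+ 3.
Proof.
pose C1 := 8 * pnorm q + 2 * pnorm (osc_deriv 1 q) + 2 * pnorm (osc_derivN (osc_deriv 1 q)).
have C10 : 0 <= C1 by rewrite !addr_ge0// mulr_ge0// pnorm_ge0.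
exists (C1 + 8 * pnorm q); first by rewrite addr_ge0// mulr_ge0// pnorm_ge0.
move=> l th l0; have s0 : 0 < Num.sqrt l by rewrite sqrtr_gt0.
have i3 : 0 <= (Num.sqrt l)^-1 ^+ 3 by rewrite exprn_ge0// invr_ge0 ltW.
rewrite mulrDl; have [l2|l2] := ltP 2 l.
  apply: (le_trans (osc1_le_large q th l2)); rewrite -/C1.
  have -> : l^-1 * (Num.sqrt l)^-1 = (Num.sqrt l)^-1 ^+ 3.
    by rewrite exprSr exprVn sqr_sqrtr ?ltW.
  by rewrite mulrC lerDl !mulr_ge0// pnorm_ge0.
(* For [l <= 2] the trivial bound [pnorm q * 2] suffices, because [Num.sqrt l ^+ 3 <= 4]; this is
   the origin of the summand [8 * pnorm q]. *)
apply: (le_trans (osc_le _ _ _ _)).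
rewrite ler_wpDl ?mulr_ge0// [8 * _]mulrC -mulrA ler_wpM2l ?pnorm_ge0//.
have sl : Num.sqrt l ^+ 2 = l by rewrite sqr_sqrtr// ltW.
rewrite exprVn ler_pdivlMr ?exprn_gt0// exprS sl; nra.
Qed.

(* Two base cases are needed since [osc_step] lowers [k] by 2. *)
Lemma osc_decay k q : exists2 C : R, 0 <= C &
  forall l th, 0 < l -> `|osc q k l th| <= C * (Num.sqrt l)^-1 ^+ k.+2.
Proof.
have sq l : 0 < l -> l^-1 = (Num.sqrt l)^-1 ^+ 2.
  by move=> l0; rewrite exprVn sqr_sqrtr// ltW.
suff : (exists2 C : R, 0 <= C & forall l th, 0 < l ->
      `|osc q k l th| <= C * (Num.sqrt l)^-1 ^+ k.+2) /\
    (exists2 C : R, 0 <= C & forall l th, 0 < l ->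
      `|osc q k.+1 l th| <= C * (Num.sqrt l)^-1 ^+ k.+3) by case.
elim: k q => [|k IH] q; split.
- exists (pnorm q * 2 + pnorm q^`() * 2).
    by rewrite addr_ge0// mulr_ge0// pnorm_ge0.
  by move=> l th l0; rewrite mulrC -sq//; exact: osc0_le.
- exact: osc1_le.
- exact: (IH q).2.
- have [C C0 H] := (IH (osc_deriv k.+2 q)).1; exists C => // l th l0.
  apply: (le_trans (osc_step _ _ _ l0)).
  have -> : (Num.sqrt l)^-1 ^+ k.+4 = l^-1 * (Num.sqrt l)^-1 ^+ k.+2.
    by rewrite sq// -exprD.
  rewrite mulrCA; apply: ler_wpM2l; first by rewrite invr_ge0 ltW.
  exact: H.
Qed.

End decay.

(** * Fourier transforms of ball indicators *)

Section ball.
Context {R : realType}.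
Notation mu := (@lebesgue_measure R).
Local Notation W := pos_sqrtX.
Local Notation w := hcirc.

(** The support of [pos_sqrtX] has to become the domain of integration, since [hcirc u ^+ 0] is 1
    everywhere; the two endpoints are negligible. *)
Lemma integral_pos_sqrtX_hcirc d (h : R -> R) : measurable_fun [set: R] h ->
  (\int[mu]_u (h u * W d (1 - u ^+ 2))%:E =
   \int[mu]_(u in `[(-1)%R, 1%R]) (h u * w u ^+ d)%:E)%E.
Proof.
move=> mh; rewrite integral_itv_bndoo; last first.
  apply: measurable_funTS; apply/measurable_EFinP; apply: measurable_funM => //.
  apply: measurable_funX; apply: continuous_measurable_fun.
  exact: continuous_hcirc.
rewrite [RHS]integral_mkcond; apply: eq_integral => u _.
rewrite patchE mem_setE in_itv/= /W.
have [u1|u1] := boolP (-1 < u < 1).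
  by rewrite subr_gt0 (_ : u ^+ 2 < 1 = true)//; move: u1 => /andP[? ?]; nra.
case: ifPn => //; last by rewrite mulr0.
by move=> H; exfalso; move/negP: u1; apply; apply/andP; split; nra.
Qed.

(** The ridge formula with [h = 1] shows that the volume is finite. *)
Lemma integrable_ind_ball d a :
  (lebesgue_Rn R d.+1).-integrable setT (EFin \o @ind_ball R d.+1 a).
Proof.
apply/integrableP; split; first by apply/measurable_EFinP; exact: measurable_ind_ball.
have [c c0 H] := @integral_ball_ridge R d.
have [m _ {}H] := H [tuple of nseq d.+1 0].
have := H a (cst 1) (measurable_cst _) (fun=> ler01).
under [X in _ = (_ * X)%E -> _]eq_integral do rewrite mul1r.
rewrite integral_pos_sqrtX => E.
rewrite (_ : (\int[_]_(x in _) _)%E = (c%:E * (pos_sqrtX_mass d * W d.+1 a)%:E)%E).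
  by rewrite -EFinM ltry.
rewrite -E; apply: eq_integral => x _ /=.
by rewrite mulr1 ger0_norm// ind_ball_ge0.
Qed.

Lemma integrable_ind_ballM d a (g : Rn R d.+1 -> R) :
  measurable_fun setT g -> (forall x, `|g x| <= 1) ->
  (lebesgue_Rn R d.+1).-integrable setT (fun x => (ind_ball a x * g x)%:E).
Proof.
move=> mg g1; apply: (le_integrable _ _ _ (@integrable_ind_ball d a)) => //.
  apply/measurable_EFinP; apply: measurable_funM => //; exact: measurable_ind_ball.
move=> x _; rewrite /= lee_fin normrM ler_piMr//.
Qed.

(** True for infinite [x] as well: [fine] sends infinities to 0, and a real multiple of an infinity
    is infinite or 0. *)
Lemma fine_EFinM (r : R) (x : \bar R) : fine (r%:E * x)%E = r * fine x.
Proof.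
case: x => [x| |] //=; rewrite mulr0.
- by rewrite mulry; case: sgrP => _; rewrite ?mul0e ?mul1e ?mulN1e.
- by rewrite mulrNy; case: sgrP => _; rewrite ?mul0e ?mul1e ?mulN1e.
Qed.

Definition ball_cos d (p : Rn R d) a th : R :=
  \int[lebesgue_Rn R d]_x (ind_ball a x * cos (dotp p x + th)).

Lemma measurable_cosD (th : R) : measurable_fun [set: R] (fun z => cos (z + th)).
Proof.
have := @continuous_cos_affine R 1 th.
by under eq_fun do rewrite mul1r; exact: continuous_measurable_fun.
Qed.

(** The ridge formula is for nonnegative functions, so it is applied to [1 + cos] and to 1, and the
    second, finite, identity is subtracted. *)
Lemma ball_cos_osc d : exists2 c : R, 0 <= c &
  forall p : Rn R d.+1, exists2 m : R, m ^+ 2 = dotp p p &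
  forall a th : R, 0 < a ->
  ball_cos p a th = c * (Num.sqrt a ^+ d.+1 * osc 1 d (m * Num.sqrt a) th).
Proof.
have [c c0 H] := @integral_ball_ridge R d; exists c => // p.
have [m mp {}H] := H p; exists m => // a th a0.
have fi (h : R -> R) : measurable_fun setT h -> (forall x, 0 <= h x) ->
    \int[lebesgue_Rn R d.+1]_x (ind_ball a x * h (dotp p x)) =
    c * (Num.sqrt a ^+ d.+1 *
      \int[mu]_(u in `[-1, 1]) (h (m * (Num.sqrt a * u)) * w u ^+ d)).
  move=> mh h0; rewrite /Rintegral H//.
  have mhm : measurable_fun [set: R] (fun t => h (m * t)).
    by apply: (measurableT_comp mh); exact: measurable_funM.
  rewrite (integral_pos_sqrtX_scale d a0 mhm)//.
  rewrite (integral_pos_sqrtX_hcirc d (h := fun u => h (m * (Num.sqrt a * u)))); last first.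
    apply: (measurableT_comp mh); apply: measurable_funM => //; exact: measurable_funM.
  by rewrite !fine_EFinM.
have mc := measurable_cosD th.
have m1c : measurable_fun [set: R] (fun z => 1 + cos (z + th)).
  exact: measurable_funD.
have mdc : measurable_fun [set: Rn R d.+1] (fun x => cos (dotp p x + th)).
  by apply: (measurableT_comp mc); exact: measurable_dotp.
have c0' z : 0 <= 1 + cos (z + th) by rewrite -lerBlDl sub0r cos_geN1.
have := fi _ m1c c0'; have := fi (cst 1) (measurable_cst _) (fun=> ler01).
move=> /= f1 f2.
have i1 : (lebesgue_Rn R d.+1).-integrable setT (EFin \o (fun x => ind_ball a x * 1)).
  by apply: integrable_ind_ballM => // x; rewrite normr1.
have i2 : (lebesgue_Rn R d.+1).-integrable setT
    (EFin \o (fun x => ind_ball a x * cos (dotp p x + th))).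
  by apply: integrable_ind_ballM => // x; exact: cos_le1_norm.
have E : \int[lebesgue_Rn R d.+1]_x (ind_ball a x * (1 + cos (dotp p x + th))) =
    \int[lebesgue_Rn R d.+1]_x (ind_ball a x * 1) + ball_cos p a th.
  by rewrite -RintegralD//; apply: eq_Rintegral => x _; rewrite mulrDr.
rewrite f1 f2 in E; apply: (addrI (c * (Num.sqrt a ^+ d.+1 *
  \int[mu]_(u in `[-1, 1]) (1 * w u ^+ d)))).
rewrite -E -!mulrDr; congr (_ * (_ * _)).
have cw : continuous (fun u : R => 1 * w u ^+ d).
  move=> u; apply: cvgM; first exact: cvg_cst.
  apply: (@continuous_comp R R R w (fun x => x ^+ d)); first exact: continuous_hcirc.
  exact: exprn_continuous.
have cc f : continuous f -> mu.-integrable `[-1, 1] (EFin \o f).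
  move=> cf; apply: continuous_compact_integrable; first exact: segment_compact.
  exact: continuous_subspaceT.
rewrite /osc -RintegralD//.
- apply: eq_Rintegral => u _.
  have -> : (1 : {poly R}).[u] = 1 by rewrite hornerE.
  by rewrite mulrDl !mul1r [cos _ * _]mulrC mulrA.
- exact: cc.
- apply: cc => u; apply: cvgM; first exact: continuous_horner_hcircX.
  exact: continuous_cos_affine.
Qed.

(** The sign of the frequency [m] in [ball_cos_osc] is unknown; parity of the cosine reduces
    negative frequencies to positive ones with phase [- th]. *)
Lemma osc_norm_decay k (q : {poly R}) : exists2 C : R, 0 <= C &
  forall l th, l != 0 -> `|osc q k l th| <= C * (Num.sqrt `|l|)^-1 ^+ k.+2.
Proof.
have [C C0 H] := osc_decay k q; exists C => // l th l0.
have [l1|l1] := ltP 0 l; first by rewrite (gtr0_norm l1) H.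
rewrite (ler0_norm l1) (_ : osc q k l th = osc q k (- l) (- th)).
  by apply: H; rewrite oppr_gt0 lt_neqAle l0.
by apply: eq_Rintegral => t _; rewrite -[in LHS]cosN opprD mulNr.
Qed.

(** The radius is [Num.sqrt a]. Its power [d.+1] from the volume scaling, against the decay of order
    [d.+2] halves in [Num.sqrt a * enorm p], leaves the power [d / 2], which is bounded for bounded
    radii. *)
Lemma ball_cos_decay d : exists2 C : R, 0 <= C &
  forall (p : Rn R d.+1) (a th : R), 0 < dotp p p ->
  `|ball_cos p a th| <=
    C * Num.sqrt (Num.sqrt a) ^+ d * (Num.sqrt (enorm p))^-1 ^+ d.+2.
Proof.
have [c c0 H] := ball_cos_osc d; have [C C0 HC] := osc_norm_decay d 1.
exists (c * C); first exact: mulr_ge0.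
move=> p a th p0; have [m mp {}H] := H p.
have pm : enorm p = `|m| by rewrite /enorm -mp sqrtr_sqr.
have m0 : m != 0 by apply: contraTneq p0 => m0; rewrite -mp m0 expr0n ltxx.
have [a0|a0] := ltP 0 a; last first.
  rewrite (_ : ball_cos p a th = 0) ?normr0.
    apply: mulr_ge0; last by rewrite exprn_ge0// invr_ge0 sqrtr_ge0.
    by apply: mulr_ge0; [exact: mulr_ge0|rewrite exprn_ge0// sqrtr_ge0].
  rewrite /ball_cos (_ : (fun x => _) = cst 0); first by rewrite Rintegral_cst// mul0r.
  by apply/funext => x; rewrite /ind_ball ltNge (le_trans a0) ?dotpp_ge0// mul0r.
have sa0 : 0 < Num.sqrt a by rewrite sqrtr_gt0.
have ra0 : 0 < Num.sqrt (Num.sqrt a) by rewrite sqrtr_gt0.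
have sn0 : 0 <= Num.sqrt a ^+ d.+1 by rewrite exprn_ge0// ltW.
rewrite H// pm normrM (ger0_norm c0) normrM (ger0_norm sn0) -!mulrA.
apply: ler_wpM2l => //.
apply: (le_trans (ler_wpM2l _ (HC _ th _))); first by rewrite exprn_ge0// ltW.
  by rewrite mulf_neq0// lt0r_neq0.
rewrite le_eqVlt; apply/orP; left; apply/eqP.
rewrite normrM (gtr0_norm sa0) sqrtrM//.
have -> : Num.sqrt a ^+ d.+1 =
    Num.sqrt (Num.sqrt a) ^+ d * Num.sqrt (Num.sqrt a) ^+ d.+2.
  transitivity (Num.sqrt (Num.sqrt a) ^+ (2 * d.+1)).
    by rewrite exprM sqr_sqrtr// ltW.
  by rewrite -exprD; congr (_ ^+ _); rewrite mul2n -addnn addSn !addnS.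
rewrite !exprVn exprMn; field.
by rewrite !expf_neq0// lt0r_neq0// sqrtr_gt0 normr_gt0.
Qed.

End ball.

(** * The layer-cake decomposition *)

Section layer.
Context {R : realType}.
Notation mu := (@lebesgue_measure R).

Lemma enorm_ge0 d (x : Rn R d) : 0 <= enorm x.
Proof. exact: sqrtr_ge0. Qed.

Lemma sqr_enorm d (x : Rn R d) : enorm x ^+ 2 = dotp x x.
Proof. by rewrite sqr_sqrtr// dotpp_ge0. Qed.

Lemma ind_ballE d (x : Rn R d) (r : R) : 0 <= r ->
  ind_ball (r ^+ 2) x = (enorm x < r)%R%:R.
Proof. by move=> r0; rewrite /ind_ball -sqr_enorm ltr_sqr// nnegrE enorm_ge0. Qed.

Context (d : nat) (p : Rn R d.+1) (r s th K : R).
Context (r0 : 0 < r) (s0 : 0 < s).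
Context (HK : forall a, a <= r ^+ 2 -> `|ball_cos p a th| <= K).

Let M := r `^ (2 * s).
(** The squared radius of the ball on which [e] stays below the level [w]. *)
Let lev (w : R) := (w `^ (2 * s)^-1) ^+ 2.
Let e (x : Rn R d.+1) := enorm x `^ (2 * s).

Let s20 : 0 < 2 * s. Proof. by rewrite mulr_gt0. Qed.
Let M0 : 0 <= M. Proof. exact: powR_ge0. Qed.

Let ltr_powR2 (x y : R) : 0 <= x -> 0 <= y -> (x `^ (2 * s) < y `^ (2 * s)) = (x < y).
Proof.
move=> x0 y0; apply/idP/idP => [|xy]; last first.
  by apply: gt0_ltr_powR => //; rewrite nnegrE.
apply: contraTT; rewrite -!leNgt => yx.
by apply: ge0_ler_powR; rewrite ?nnegrE// ltW.
Qed.

Let powRK (w : R) : 0 <= w -> (w `^ (2 * s)^-1) `^ (2 * s) = w.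
Proof. by move=> w0; rewrite -powRrM mulVf ?lt0r_neq0// powRr1. Qed.

Let ind_lev w x : 0 <= w -> ind_ball (lev w) x = (e x < w)%R%:R.
Proof.
move=> w0; rewrite ind_ballE ?powR_ge0//; congr (nat_of_bool _)%:R.
by rewrite -ltr_powR2 ?enorm_ge0 ?powR_ge0// powRK.
Qed.

Let lev_le w : 0 <= w <= M -> lev w <= r ^+ 2.
Proof.
move=> /andP[w0 wM]; have ra := ltW r0.
rewrite /lev ler_sqr ?nnegrE ?powR_ge0// leNgt -ltr_powR2 ?powR_ge0//.
by rewrite powRK// -leNgt.
Qed.

(** For fixed [x] the integrand is the indicator of []e x, M]], an interval that is empty exactly
    when [x] lies outside the ball of radius [r]. *)
Let layer x :
  (\int[mu]_w (\1_(`[0%R, M] : set R) w * ind_ball (lev w) x)%:E =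
   (ind_ball (r ^+ 2) x * (M - e x))%:E)%E.
Proof.
have e0 : 0 <= e x by exact: powR_ge0.
transitivity (\int[mu]_w (\1_(`]e x, M] : set R) w)%:E)%E.
  apply: eq_integral => w _; rewrite !indicE !mem_setE !in_itv/=.
  have [w0|w0] := leP 0 w; last first.
    by rewrite mul0r ltNge (le_trans (ltW w0) e0).
  by rewrite ind_lev//; case: (_ < _); case: (_ <= _); rewrite /= ?mulr1 ?mulr0 ?mul1r.
rewrite integral_indic// setIT/= lebesgue_measure_itv/= lte_fin ind_ballE ?(ltW r0)//.
rewrite -(@ltr_powR2 _ r) ?enorm_ge0 ?(ltW r0)//.
by case: ifPn => _; rewrite ?mul1r ?mul0r// EFinB.
Qed.

Let F (z : R * Rn R d.+1) : \bar R :=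
  (\1_(`[0%R, M] : set R) z.1 * ind_ball (lev z.1) z.2 * cos (dotp p z.2 + th))%:E.

Let mJ : measurable_fun [set: R * Rn R d.+1]
  (fun z => \1_(`[0%R, M] : set R) z.1 * ind_ball (lev z.1) z.2 : R).
Proof.
apply: measurable_funM.
  by apply: (measurableT_comp (measurable_indic _)).
rewrite (_ : (fun z => _) = fun z : R * Rn R d.+1 =>
  if dotp z.2 z.2 < lev z.1 then 1 else 0); last first.
  by apply/funext => x; rewrite /ind_ball; case: ifP.
apply: measurable_fun_ifT => //; apply: measurable_fun_ltr.
  by apply: (measurableT_comp (@measurable_dotpp R d.+1)).
apply: measurable_funX.
by apply: (measurableT_comp (measurable_powR _)).
Qed.

Let mF : measurable_fun setT F.
Proof.
apply/measurable_EFinP; apply: measurable_funM; first exact: mJ.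
apply: (measurableT_comp (measurable_cosD th)).
by apply: (measurableT_comp (measurable_dotp p)).
Qed.

(** Each layer is contained in the ball of squared radius [r ^+ 2], so the absolute integral is at
    most [M] times the volume of that ball. *)
Let iF : (mu \x lebesgue_Rn R d.+1)%E.-integrable setT F.
Proof.
apply: (integrable12ltyP mu (lebesgue_Rn R d.+1) mF).2.
have iV := @integrable_ind_ball R d (r ^+ 2).
have fV := integrable_fin_num measurableT iV.
set V := (\int[lebesgue_Rn R d.+1]_x (EFin \o ind_ball (r ^+ 2)) x)%E in fV.
have V0 : (0 <= V)%E by apply: integral_ge0 => x _; rewrite lee_fin ind_ball_ge0.
apply: (@le_lt_trans _ _ (\int[mu]_w (V * (\1_(`[0%R, M] : set R) w)%:E))%E).
  apply: ge0_le_integral => //.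
  - by move=> w _; apply: integral_ge0 => x _; exact: abse_ge0.
  - apply: (measurable_fun_fubini_tonelli_F (m2 := lebesgue_Rn R d.+1) (abse \o F)).
      exact: measurableT_comp mF.
    by move=> z; exact: abse_ge0.
  - apply: measurable_funeM; apply/measurable_EFinP; exact: measurable_indic.
  move=> w _; rewrite indicE mem_setE in_itv/=.
  have [w0|w0] := boolP (0 <= w <= M); last first.
    rewrite mulr0n mule0 integral0_eq// => x _.
    by rewrite /F /= indicE mem_setE in_itv/= (negbTE w0) !mul0r normr0.
  rewrite mule1; apply: ge0_le_integral => //.
  - have mFw : measurable_fun setT (fun x => F (w, x)) by apply: (measurableT_comp mF).
    exact: (measurableT_comp (@abse_measurable R setT) mFw).
  - by apply/measurable_EFinP; exact: measurable_ind_ball.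
  move=> x _; rewrite /F /= lee_fin indicE mem_setE in_itv/= w0 mul1r.
  rewrite normrM -[leRHS]mulr1; apply: ler_pM => //; last exact: cos_le1_norm.
  rewrite ger0_norm ?ind_ball_ge0// /ind_ball ler_nat.
  case: ltP => //= xw; rewrite (lt_le_trans xw)// lev_le//.
rewrite ge0_integralZl//; last by apply/measurable_EFinP; exact: measurable_indic.
rewrite integral_indic// setIT/= lebesgue_measure_itv/= lte_fin.
rewrite -(fineK fV); case: ifPn => _; last by rewrite mule0 ltry.
by rewrite -EFinB -EFinM ltry.
Qed.

Let FG x : (\int[mu]_w F (w, x) = (ind_ball (r ^+ 2) x * (M - e x) * cos (dotp p x + th))%:E)%E.
Proof.
rewrite EFinM -layer muleC -integralZl//.
  by apply: eq_integral => w _; rewrite /F /= -EFinM mulrC.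
have Je w : (\1_(`[0%R, M] : set R) w * ind_ball (lev w) x)%:E =
    `|(\1_(`[0%R, M] : set R) w * ind_ball (lev w) x)%:E|%E.
  by rewrite /= ger0_norm// mulr_ge0// ind_ball_ge0.
apply/integrableP; split.
  by apply/measurable_EFinP; exact: (measurableT_comp mJ (pair2_measurable x)).
by under eq_integral do rewrite -Je; rewrite layer ltry.
Qed.

Let FF w : (\int[lebesgue_Rn R d.+1]_x F (w, x) =
  (\1_(`[0%R, M] : set R) w * ball_cos p (lev w) th)%:E)%E.
Proof.
have iB : (lebesgue_Rn R d.+1).-integrable setT
    (EFin \o (fun x => ind_ball (lev w) x * cos (dotp p x + th))).
  apply: integrable_ind_ballM => [|x]; last exact: cos_le1_norm.
  by apply: (measurableT_comp (measurable_cosD th)); exact: measurable_dotp.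
rewrite EFinM /ball_cos /Rintegral fineK; last exact: integrable_fin_num iB.
rewrite -integralZl//.
by apply: eq_integral => x _; rewrite /F /= -EFinM mulrA.
Qed.

Let g (x : Rn R d.+1) := ind_ball (r ^+ 2) x * (M - e x) * cos (dotp p x + th).

Let ig : (lebesgue_Rn R d.+1).-integrable setT (EFin \o g).
Proof.
have mg : measurable_fun setT (EFin \o g).
  have := measurable_fubini_G iF.
  by congr measurable_fun; apply/funext => x; rewrite /fubini_G FG.
apply: (le_integrable _ mg _ (_ : _.-integrable _ (fun x => M%:E * (ind_ball (r ^+ 2) x)%:E)%E)) => //.
  move=> x _; rewrite /= lee_fin /g normrM -[leRHS]mulr1.
  rewrite [`|M * _|]ger0_norm ?mulr_ge0 ?ind_ball_ge0//.
  apply: ler_pM => //; last exact: cos_le1_norm.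
  rewrite normrM (ger0_norm (ind_ball_ge0 _ _)) mulrC ind_ballE ?(ltW r0)//.
  have [xr|xr] := ltP (enorm x) r; last by rewrite !mulr0.
  rewrite !mulr1 ger0_norm ?lerBlDr ?lerDl ?powR_ge0// subr_ge0.
  by rewrite ge0_ler_powR ?nnegrE ?enorm_ge0// ltW.
by apply: integrableZl => //; exact: integrable_ind_ball.
Qed.

(** By Fubini, space is integrated out at each level [w], which leaves [ball_cos] at squared radius
    [lev w], bounded by [K] on an interval of levels of length [M]. *)
Let g_le : `|\int[lebesgue_Rn R d.+1]_x g x| <= M * K.
Proof.
have fg := integrable_fin_num measurableT ig.
rewrite -lee_fin /Rintegral -[X in (X <= _)%E]/(`|(fine _)%:E|%E) fineK//.
rewrite (_ : (\int[_]_x _)%E = (\int[mu]_w (\1_(`[0%R, M] : set R) w * ball_cos p (lev w) th)%:E)%E).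
  have iL : mu.-integrable setT
      (fun w => (\1_(`[0%R, M] : set R) w * ball_cos p (lev w) th)%:E).
    have := integrable_fubini_F iF.
    by congr (_.-integrable _ _); apply/funext => w; rewrite /fubini_F FF.
  have mL := measurable_int mu iL.
  apply: (le_trans (le_abse_integral _ measurableT mL)).
  apply: (@le_trans _ _ (\int[mu]_w (K%:E * (\1_(`[0%R, M] : set R) w)%:E))%E).
    apply: ge0_le_integral => //.
    - exact: measurableT_comp.
    - by apply: measurable_funeM; apply/measurable_EFinP; exact: measurable_indic.
    move=> w _; rewrite -EFinM /= lee_fin indicE mem_setE in_itv/=.
    have [w0|w0] := boolP (0 <= w <= M); last by rewrite mul0r mulr0 normr0.
    by rewrite mul1r mulr1 HK// lev_le.
  rewrite integralZl//; last first.
    apply/integrableP; split; first by apply/measurable_EFinP; exact: measurable_indic.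
    under eq_integral do rewrite /= ger0_norm//.
    rewrite integral_indic// setIT/= lebesgue_measure_itv/= lte_fin.
    by case: ifPn => _; rewrite -?EFinB ltry.
  rewrite integral_indic// setIT/= lebesgue_measure_itv/= lte_fin.
  have [M1|M1] := ltP 0 M; first by rewrite -EFinB -EFinM subr0 mulrC.
  by rewrite mule0 lee_fin (_ : M = 0) ?mul0r//; apply/eqP; rewrite eq_le M1 M0.
transitivity (\int[lebesgue_Rn R d.+1]_x \int[mu]_w F (w, x))%E.
  by apply: eq_integral => x _; rewrite FG.
rewrite -(Fubini iF).
by apply: eq_integral => w _; rewrite FF.
Qed.

(** On the ball [e x = M - (M - e x)]; the constant part and the layered part [g] each cost
    [M * K]. *)
Lemma ball_powR_cos_le :
  `|\int[lebesgue_Rn R d.+1]_(x in eball r) (enorm x `^ (2 * s) * cos (dotp p x + th))|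
    <= 2 * M * K.
Proof.
have iB1 : (lebesgue_Rn R d.+1).-integrable setT
    (EFin \o (fun x => (ind_ball (r ^+ 2) x * cos (dotp p x + th)))).
  apply: integrable_ind_ballM => [|x]; last exact: cos_le1_norm.
  by apply: (measurableT_comp (measurable_cosD th)); exact: measurable_dotp.
have iB : (lebesgue_Rn R d.+1).-integrable setT
    (EFin \o (fun x => M * (ind_ball (r ^+ 2) x * cos (dotp p x + th)))).
  exact: (integrableZl measurableT M iB1).
rewrite Rintegral_mkcond.
rewrite (_ : Rintegral _ _ _ = M * ball_cos p (r ^+ 2) th - \int[lebesgue_Rn R d.+1]_x g x).
  apply: (le_trans (ler_normB _ _)); rewrite -mulrA mulr_natl mulr2n.
  apply: lerD => //; rewrite normrM (ger0_norm M0); apply: ler_wpM2l => //.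
  exact: HK.
rewrite /ball_cos -RintegralZl// -RintegralB//.
apply: eq_Rintegral => x _; rewrite patchE /g ind_ballE ?(ltW r0)//.
rewrite (_ : (x \in eball r) = (enorm x < r)); last first.
  by apply/idP/idP; rewrite inE.
case: ifPn => _ /=; first by rewrite /e; ring.
by rewrite !mul0r mulr0 subrr.
Qed.

End layer.

(** * Decay of the matrix entries *)

Local Open Scope complex_scope.

Lemma normc_le_ReIm (R : rcfType) (z : R[i]) :
  `|z| <= (`|complex.Re z| + `|complex.Im z|)%:C.
Proof.
have h : 0 <= `|complex.Re z| + `|complex.Im z| by rewrite addr_ge0.
rewrite normc_def lecR -[leRHS](ger0_norm h) -[leRHS]sqrtr_sqr ler_wsqrtr//.
rewrite sqrrD -(real_normK (num_real (complex.Re z))) -(real_normK (num_real (complex.Im z))).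
by rewrite addrAC lerDl mulrn_wge0// mulr_ge0.
Qed.

Lemma ball_powR_cos_decay (R : realType) (d : nat) (s r : R) : 0 < s ->
  exists2 C : R, 0 <= C & forall (p : Rn R d.+1) (th : R), 0 < enorm p ->
  `|\int[lebesgue_Rn R d.+1]_(x in eball r) (enorm x `^ (2 * s) * cos (dotp p x + th))|
  <= C * (enorm p `^ ((d.+1%:R + 1) / 2))^-1.
Proof.
move=> s0; have [C C0 HC] := @ball_cos_decay R d.
have [r0|r0] := ltP 0 r; last first.
  exists 0 => // p th _; rewrite mul0r (_ : eball r = set0) ?Rintegral_set0 ?normr0//.
  apply/seteqP; split=> x //=; rewrite /eball/= ltNge => /negP[].
  by rewrite (le_trans r0)// enorm_ge0.
pose B := C * Num.sqrt (Num.sqrt (r ^+ 2)) ^+ d.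
have B0 : 0 <= B by rewrite mulr_ge0// exprn_ge0// sqrtr_ge0.
exists (2 * r `^ (2 * s) * B).
  by apply: mulr_ge0 => //; apply: mulr_ge0 => //; exact: powR_ge0.
move=> p th p0.
have -> : (enorm p `^ ((d.+1%:R + 1) / 2))^-1 = (Num.sqrt (enorm p))^-1 ^+ d.+2.
  rewrite exprVn; congr (_^-1).
  rewrite -powR12_sqrt ?ltW// -powR_mulrn ?powR_ge0// -powRrM; congr (_ `^ _).
  by rewrite mulrC -(natrD _ d.+1 1) addn1.
rewrite -mulrA; apply: ball_powR_cos_le => // a ar.
have pp0 : 0 < dotp p p by rewrite -sqrtr_gt0.
apply: (le_trans (HC p a th pp0)); apply: ler_wpM2r.
  by rewrite exprn_ge0// invr_ge0 sqrtr_ge0.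
apply: ler_wpM2l => //; apply: lerXn2r; rewrite ?nnegrE ?sqrtr_ge0//.
by rewrite !ler_wsqrtr.
Qed.

Theorem proposition1 (R : realType) (d : nat) (s : R) :
  (1 <= d)%N -> 0 < s < 1 ->
  let F := index_infty R d in
  (T_tilde s : d.-tuple int -> R[i]^o) =O_F
  (fun p => ((enorm (multi_index R p) `^ ((d%:R + 1) / 2))^-1)%:C : R[i]^o).
Proof.
case: d => // d _ /andP[s0 _] F.
have [C C0 HC] := @ball_powR_cos_decay R d s (Defs.radius R d.+1) s0.
pose k : R := ((2 * pi) ^+ d.+1)^-1.
have k0 : 0 <= k by rewrite invr_ge0 exprn_ge0// mulr_ge0// pi_ge0.
(* The real and imaginary parts contribute [k * C] each, and the added 1 makes the constant strictly
   positive. The estimate holds for every nonzero [p], hence the threshold 0. *)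
apply/eqO_exP; exists (k * (2 * C) + 1)%:C.
  by rewrite ltcR ltr_wpDl// mulr_ge0// mulr_ge0.
exists 0 => // p /= p0.
set D := (enorm (multi_index R p) `^ _)^-1.
have D0 : 0 <= D by rewrite invr_ge0 powR_ge0.
rewrite /T_tilde -/k normrM.
have nC (x : R) : 0 <= x -> `|x%:C| = x%:C.
  by move=> x0; rewrite ger0_norm// lecR.
rewrite !nC//; set z := cintegral _ _ _.
have Rez : `|complex.Re z| <= C * D.
  have := HC (multi_index R p) 0 p0.
  congr (`|_| <= _); apply: eq_Rintegral => x _.
  by rewrite /= !(mul0r, mul1r, mulr0, subr0, addr0, add0r, oppr0, expR0).
(* The imaginary part carries the sine, that is, the cosine of phase [- (pi / 2)]. *)
have Imz : `|complex.Im z| <= C * D.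
  have := HC (multi_index R p) (- (pi / 2)) p0.
  congr (`|_| <= _); apply: eq_Rintegral => x _.
  by rewrite /= cosBpihalf !(mul0r, mul1r, mulr0, subr0, addr0, add0r, oppr0, expR0).
apply: (@le_trans _ _ (k%:C * (C * D + C * D)%:C)).
  apply: ler_wpM2l; first by rewrite lecR.
  by apply: (le_trans (normc_le_ReIm _)); rewrite lecR lerD.
rewrite -!rmorphM lecR mulrDl mul1r.
have -> : k * (C * D + C * D) = k * (2 * C) * D by ring.
by rewrite lerDl.
Qed.
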